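(* Let $m,d$ be positive integers and let $\Gamma^+_{m,d}$ be the set of all $m$-tuples $\alpha=(\alpha_1,\ldots,\alpha_m)$ of non-negative integers with $\sum_i\alpha_i=d$. Define the class function $Q_d$ on $S_m$ by $Q_d(\sigma)=$ the number of non-negative integer solutions $(t_1,\ldots,t_n)$ of $a_1t_1+\cdots+a_nt_n=d$, where $\sigma$ is a product of $n$ disjoint cycles of lengths $a_1,\ldots,a_n$ (fixed points counted as cycles of length $1$, so $a_1+\cdots+a_n=m$). Then $$Q_d=\frac{1}{m!}\sum_{\alpha\in\Gamma^+_{m,d}}\ \sum_{\pi:\ M(\alpha)\unlhd\pi}M(\alpha)!\,K_{\pi,M(\alpha)}\,\chi^{\pi},$$ where the inner sum runs over all partitions $\pi$ of $m$ with $M(\alpha)\unlhd\pi$.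
   Context: For a partition $\pi$ of $m$, $\chi^\pi$ denotes the irreducible complex character of $S_m$ corresponding to $\pi$. For partitions $\lambda=(\lambda_1,\ldots,\lambda_s)$ and $\mu=(\mu_1,\ldots,\mu_l)$ of $m$, write $\lambda\unlhd\mu$ ($\mu$ majorizes $\lambda$) if $\lambda_1+\cdots+\lambda_i\le\mu_1+\cdots+\mu_i$ for all $i$ (parts beyond the length being taken as $0$). For $\alpha\in\Gamma^+_{m,d}$, the multiplicity partition $M(\alpha)$ is the partition of $m$ obtained by arranging in descending order the (nonzero) multiplicities with which the numbers $0,1,\ldots,d$ occur among $\alpha_1,\ldots,\alpha_m$; if $M(\alpha)=(k_1,\ldots,k_s)$ then $M(\alpha)!=k_1!k_2!\cdots k_s!$. For partitions $\mu,\lambda$ of $m$, the Kostka number $K_{\mu\lambda}$ is the number of semi-standard tableaux of shape $\mu$ and content $\lambda$, i.e. fillings of the Young diagram of $\mu$ with entries from $\{1,2,\ldots\}$ in which the value $i$ occurs exactly $\lambda_i$ times, rows are weakly increasing and columns are strictly increasing; equivalently $K_{\mu\lambda}$ is the multiplicity of $\chi^\mu$ in the character of $S_m$ induced from the trivial character of the Young subgroup $S_{\lambda_1}\times\cdots\times S_{\lambda_s}$. *)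

(* Defs.v *)
(* Complex characters are represented, as in mathcomp.character, by algC-valued
   class functions; characters of a finite group take algebraic values. *)
From HB Require Import structures.
From mathcomp Require Import all_boot all_order all_algebra all_fingroup.
From mathcomp Require Import all_solvable all_field all_character.

Set Implicit Arguments.
Unset Strict Implicit.
Unset Printing Implicit Defensive.

Import GRing.Theory.

Local Open Scope nat_scope.

Definition is_intpartn (m : nat) (s : seq nat) : bool :=
  [&& sorted geq s, 0 \notin s & sumn s == m].

Record intpartn (m : nat) : Type :=
  IntPartn { intpartn_val :> seq nat; intpartnP : is_intpartn m intpartn_val }.

HB.instance Definition _ m := [isSub for @intpartn_val m].
HB.instance Definition _ m := [Countable of intpartn m by <:].

Section IntPartnFinite.
Variable m : nat.

Lemma intpartn_size (p : intpartn m) : size p <= m.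
Proof.
case: p => s /= /and3P[_ s_gt0 /eqP<-].
elim: s s_gt0 => //= a s IHs; rewrite inE negb_or eq_sym -lt0n.
by case/andP=> a_gt0 /IHs; rewrite -add1n; apply: leq_add.
Qed.

Lemma intpartn_leq (p : intpartn m) (a : nat) : a \in (p : seq nat) -> a <= m.
Proof.
case: p => s /= /and3P[_ _ /eqP<-].
elim: s => //= b s IHs; rewrite inE => /predU1P[->|/IHs le_a].
  exact: leq_addr.
exact: leq_trans le_a (leq_addl _ _).
Qed.

Definition intpartn_bseq (p : intpartn m) : m.-bseq 'I_m.+1 :=
  insub_bseq m (map inord p).
Definition bseq_intpartn (s : m.-bseq 'I_m.+1) : option (intpartn m) :=
  insub (map val s).

Lemma intpartn_bseqK : pcancel intpartn_bseq bseq_intpartn.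
Proof.
move=> p; rewrite /bseq_intpartn /intpartn_bseq.
rewrite /insub_bseq val_insubd size_map intpartn_size -map_comp.
suffices ->: [seq (val \o @inord m) i | i <- p] = p by rewrite valK.
rewrite -[RHS]map_id; apply/eq_in_map=> a p_a /=.
by rewrite inordK // ltnS; apply: intpartn_leq p_a.
Qed.

End IntPartnFinite.

HB.instance Definition _ m :=
  isFinite.Build (intpartn m) (pcan_enumP (@intpartn_bseqK m)).

(* [dominated la mu] is la <| mu (mu majorizes la); see [dominatedP]. *)
Definition dominated (la mu : seq nat) : bool :=
  all (fun i => sumn (take i la) <= sumn (take i mu))
      (iota 0 (maxn (size la) (size mu)).+1).

Lemma dominatedP (la mu : seq nat) :
  reflect (forall i, sumn (take i la) <= sumn (take i mu)) (dominated la mu).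
Proof.
apply: (iffP allP) => [le_s i | le_s i _]; last exact: le_s.
set k := maxn (size la) (size mu) in le_s.
have [le_ik | /ltnW le_ki] := leqP i k.
  by apply: le_s; rewrite mem_iota.
have := le_s k; rewrite mem_iota leqnn => /(_ isT).
by rewrite !take_oversize // ?(leq_trans _ le_ki) ?leq_maxl ?leq_maxr.
Qed.

(* The entries of an m-tuple of naturals with sum d are at most d. *)
Definition Gamma (m d : nat) : {set m.-tuple 'I_d.+1} :=
  [set a : m.-tuple 'I_d.+1 | \sum_(i < m) tnth a i == d].

(* M(alpha); it is a partition of m by [mult_partn_is_intpartn]. *)
Definition mult_partn (m d : nat) (a : m.-tuple 'I_d.+1) : seq nat :=
  sort geq [seq k <- [seq count_mem j a | j <- enum 'I_d.+1] | k != 0].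

Definition partn_fact (la : seq nat) : nat := \prod_(k <- la) k`!.

Lemma mult_partn_is_intpartn (m d : nat) (a : m.-tuple 'I_d.+1) :
  is_intpartn m (mult_partn a).
Proof.
apply/and3P; split.
- by apply: sort_sorted => x y; apply: leq_total.
- by rewrite mem_sort mem_filter.
rewrite /mult_partn sumnE (perm_big _ (permEl (perm_sort _ _))) /=.
rewrite big_filter big_mkcond big_map /= big_enum /=.
rewrite (eq_bigr (fun j => count_mem j a)) => [|j _]; last by case: eqP.
rewrite -[X in _ == X](size_tuple a) -sum1_size.
rewrite [X in _ == X](partition_big id predT) //=.
by apply/eqP/eq_bigr=> j _; rewrite sum1_count.
Qed.

(* The boxes (r, c) of the Young diagram of mu, with r < size mu and c < mu_r
   (rows and columns are numbered from 0). *)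
Definition cell (mu : seq nat) : Type :=
  {r : 'I_(size mu) & 'I_(nth 0 mu r)}.
HB.instance Definition _ mu := Finite.on (cell mu).

Definition cell_row (mu : seq nat) (x : cell mu) : nat := tag x.
Definition cell_col (mu : seq nat) (x : cell mu) : nat := tagged x.

(* Entries are shifted by one: k : 'I_(size la) stands for the value k + 1. *)
Definition is_ssyt (mu la : seq nat) (T : {ffun cell mu -> 'I_(size la)}) :
  bool :=
  [&& [forall x : cell mu, forall y : cell mu,
         (cell_row x == cell_row y) && (cell_col x < cell_col y)
           ==> (T x <= T y)],
      [forall x : cell mu, forall y : cell mu,
         (cell_col x == cell_col y) && (cell_row x < cell_row y)
           ==> (T x < T y)]
    & [forall k : 'I_(size la),
         #|[set x : cell mu | T x == k]| == nth 0 la k]].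

Definition Kostka (mu la : seq nat) : nat :=
  #|[set T : {ffun cell mu -> 'I_(size la)} | is_ssyt T]|.

(* [porbits s] contains the fixed points of s as singletons. *)
Definition cycle_type (m : nat) (s : 'S_m) : seq nat :=
  sort geq [seq #|C| | C : {set 'I_m} <- enum (porbits s)].

(* The number of solutions of a_1 t_1 + ... + a_n t_n = d in naturals t_i.
   Only applied to positive a_i, for which t_i <= d holds automatically. *)
Definition nb_solutions (d : nat) (a : seq nat) : nat :=
  #|[set t : (size a).-tuple 'I_d.+1 |
       \sum_(i < size a) nth 0 a i * tnth t i == d]|.

Lemma cycle_typeJ (m : nat) (s x : 'S_m) : cycle_type (s ^ x)%g = cycle_type s.
Proof.
have porbitJ i : porbit (s ^ x)%g (x i) = x @: porbit s i.
  apply/setP=> j; apply/porbitP/imsetP=> [[k ->] | [_ /porbitP[k ->] ->]].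
    exists ((s ^+ k)%g i); first exact: mem_porbit.
    by rewrite -conjXg permJ.
  by exists k; rewrite -conjXg permJ.
have porbitsJ : porbits (s ^ x)%g = [set x @: C | C : {set 'I_m} in porbits s].
  apply/setP=> C; apply/imsetP/imsetP=> [[i _ ->] | [_ /imsetP[i _ ->] ->]].
    exists (porbit s (x^-1%g i)); first exact: imset_f.
    by rewrite -porbitJ permKV.
  by exists (x i); rewrite ?porbitJ.
have inj_x : injective (fun C : {set 'I_m} => x @: C).
  exact/imset_inj/perm_inj.
have geq_total : total geq by move=> a b; apply: leq_total.
have geq_trans : transitive geq by move=> b a c ba cb; apply: leq_trans cb ba.
have geq_anti : antisymmetric geq by move=> a b; rewrite andbC => /anti_leq.
apply/(perm_sortP geq_total geq_trans geq_anti).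
have perm_J : perm_eq (enum (porbits (s ^ x)%g))
                      [seq x @: C | C : {set 'I_m} <- enum (porbits s)].
  apply: uniq_perm; rewrite ?enum_uniq ?map_inj_uniq ?enum_uniq //.
  move=> C; rewrite mem_enum porbitsJ.
  by apply/imsetP/mapP=> -[D sD ->]; exists D; rewrite // mem_enum in sD *.
apply: perm_trans (perm_map _ perm_J) _; rewrite -map_comp.
rewrite (eq_map (g := fun C : {set 'I_m} => #|C|)) // => C /=.
exact/card_imset/perm_inj.
Qed.

Local Open Scope ring_scope.

Fact Q_subproof (m d : nat) :
  is_class_fun <<[set: 'S_m]>>%g
    [ffun s : 'S_m => (nb_solutions d (cycle_type s))%:R : algC].
Proof.
rewrite genGid.
by apply: intro_class_fun => [s x _ _ | s]; rewrite ?cycle_typeJ ?inE.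
Qed.

Definition Q (m d : nat) : 'CF([set: 'S_m]) := Cfun 0 (@Q_subproof m d).

(* The row-reading tableau of shape pi puts i : 'I_m in the box of row
   [reshape_index pi i] and column [reshape_offset pi i]; the following are
   its row and column stabilizers. *)
Definition row_stab (m : nat) (pi : seq nat) : {set 'S_m} :=
  [set p : 'S_m |
    [forall i : 'I_m, reshape_index pi (p i) == reshape_index pi i]].

Definition col_stab (m : nat) (pi : seq nat) : {set 'S_m} :=
  [set q : 'S_m |
    [forall i : 'I_m, reshape_offset pi (q i) == reshape_offset pi i]].

(* The Young symmetrizer \sum_p \sum_q sgn(q) p q in the group algebra, as a
   vector of the regular representation. *)
Definition young_symmetrizer (m : nat) (pi : seq nat) :
    'rV[algC]_(gcard [set: 'S_m]) :=
  \sum_(p in row_stab m pi) \sum_(q in col_stab m pi)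
     (-1) ^+ (q : bool) *: delta_mx 0 (gring_index [set: 'S_m] (p * q)%g).

(* chi^pi is the character of the Specht module of pi, i.e. of the submodule of
   the regular representation generated by the Young symmetrizer. *)
Definition specht_char (m : nat) (pi : seq nat) : 'CF([set: 'S_m]) :=
  cfRepr (submod_repr (cyclic_mx_module (regular_repr algC [set: 'S_m])
                                        (young_symmetrizer m pi))).

(* Main.v *)
(* Write M^la for the character of S_m induced from the trivial character of a
   Young subgroup of type la. Grouping the words alpha fixed by a permutation
   into orbits gives m! Q_d = sum_alpha M(alpha)! M^{M(alpha)}, so the theorem
   reduces to Young's rule M^la = sum_pi K_{pi,la} chi^pi.

   The Young symmetrizers show, by the usual sandwich argument, that the Specht
   characters are orthonormal and that '[M^pi, chi^pi] = 1. By Burnside's lemma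
   '[M^la, M^mu] is the number of nonnegative integer matrices with row sums la
   and column sums mu, and that number is also sum_pi K_{pi,la} K_{pi,mu} (the
   RSK identity, obtained here by toggling interlacing shapes). As K is
   unitriangular for the dominance order, descending induction on pi shows that
   X = M^pi - sum_{nu > pi} K_{nu,pi} chi^nu has norm 1, and '[X, chi^pi] = 1
   then forces X = chi^pi. *)
Require Import Defs.
From mathcomp Require Import all_boot all_order all_algebra all_fingroup.
From mathcomp Require Import all_solvable all_field all_character.
From mathcomp Require Import zify.

Set Implicit Arguments.
Unset Strict Implicit.
Unset Printing Implicit Defensive.

Import GroupScope Order.TTheory GRing.Theory Num.Theory.

Local Open Scope nat_scope.

(** * Interlacing shapes and the RSK identity *)

(** The Specht characters are known to be orthonormal, but not to exhaust the irreducible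
    characters, so no expansion of [M^la] in them is available beforehand; exact norms take the
    place of completeness. To evaluate all pairings in one way, a character is attached to an
    element [A] of the group algebra by [affords], up to a scalar. Young symmetrizers and sums over
    subgroups both fit, and a pairing becomes the trace of [h |-> A h E], which reduces to the
    coefficient of the identity in a product once every [A h E] is a multiple of [E]. The RSK
    identity is needed only as an equality of cardinalities, so no insertion algorithm appears. If
    [U_k] adds and [D_l] removes a horizontal strip of the given size, the local rule is
    [D_l U_k = sum_j U_(k-j) D_(l-j)]. Moving the steps of one chain through those of the other by
    this rule leaves a family of numbers [j], and these are the entries of the matrix. *)

Lemma card_bij (S T : finType) (A : {set S}) (B : {set T}) (f : S -> T)
    (g : T -> S) :
  {in A, forall x, f x \in B} -> {in B, forall y, g y \in A} ->
  {in A, cancel f g} -> {in B, cancel g f} -> #|A| = #|B|.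
Proof.
move=> fB gA fK gK; rewrite -(card_in_imset (can_in_inj fK)).
apply: eq_card => y; apply/imsetP/idP => [[x Ax ->]|By]; first exact: fB.
by exists (g y); rewrite ?gA ?gK.
Qed.

Section Strips.

Variable m : nat.

(** A finite box, so that sums over shapes make sense. It has one row more than a shape of weight at
    most [m] can fill: row [m] is then empty, and moving rows by one index loses nothing. *)
Definition rowlens := {ffun 'I_m.+1 -> 'I_m.+1}.
Implicit Types x y z : rowlens.

Definition part x (i : nat) : nat := oapp (fun j => x j : nat) 0 (insub i).

Definition mk_shape (f : nat -> nat) : rowlens := [ffun i : 'I_m.+1 => inord (f i)].

Definition weight x := \sum_(i < m.+1) part x i.

(* x / y is a horizontal strip; in particular x and y are weakly decreasing. *)
Definition strip y x :=
  [forall i : 'I_m.+1, (part y i <= part x i) && (part x i.+1 <= part y i)].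

Lemma part_ord x (i : 'I_m.+1) : part x i = x i.
Proof. by rewrite /part valK. Qed.

Lemma part_out x i : m < i -> part x i = 0.
Proof. by move=> lt_mi; rewrite /part insubF // ltnS leqNgt lt_mi. Qed.

Lemma part_le x i : part x i <= m.
Proof.
have [lt_mi|le_im] := ltnP m i; first by rewrite part_out.
by rewrite (part_ord x (Ordinal (le_im : i < m.+1))) -ltnS ltn_ord.
Qed.

Lemma part_mk f : (forall i, f i <= m) -> (forall i, m < i -> f i = 0) ->
  forall i, part (mk_shape f) i = f i.
Proof.
move=> f_le f_out i; have [lt_mi|le_im] := ltnP m i.
  by rewrite part_out ?f_out.
by rewrite (part_ord _ (Ordinal (le_im : i < m.+1))) ffunE inordK ?ltnS.
Qed.

Lemma eq_shape x y : (forall i, part x i = part y i) -> x = y.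
Proof. move=> eq_xy; apply/ffunP=> i; apply/val_inj.
by have := eq_xy i; rewrite !part_ord. Qed.

Lemma stripP y x :
  reflect (forall i, part y i <= part x i /\ part x i.+1 <= part y i)
          (strip y x).
Proof.
apply: (iffP forallP) => [xy i|xy i]; last by apply/andP/xy.
have [lt_mi|le_im] := ltnP m i; first by rewrite !part_out // ltnW.
exact/andP/(xy (Ordinal (le_im : i < m.+1))).
Qed.

Lemma part_le_weight x i : part x i <= weight x.
Proof.
have [lt_mi|le_im] := ltnP m i; first by rewrite part_out.
by rewrite /weight (bigD1 (Ordinal (le_im : i < m.+1))) //= leq_addr.
Qed.

(** The strip makes [x] weakly decreasing, so a nonempty row [m] would force [m.+1] nonempty
    rows. *)
Lemma part_last x y : weight x <= m -> strip y x -> part x m = 0.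
Proof.
move=> le_xm /stripP xy; apply/eqP; rewrite -leqn0 leqNgt; apply/negP=> x_gt0.
suff: m.+1 <= weight x by rewrite leqNgt ltnS le_xm.
rewrite -[X in X <= _]card_ord -sum1_card; apply: leq_sum => i _.
apply: leq_trans x_gt0 _; have: i <= m by rewrite -ltnS.
elim: {i}(m - i) {-2}(i : nat) (erefl (m - i)) => [|k IHk] i eq_k le_im.
  by rewrite (_ : (i : nat) = m) //; lia.
apply: leq_trans (IHk i.+1 _ _) _; try lia.
by have [? ?] := xy i; lia.
Qed.

Lemma weight_sum_shift x : part x m = 0 -> weight x = \sum_(i < m) part x i.
Proof. by move=> x0; rewrite /weight big_ord_recr /= x0 addn0. Qed.

Lemma weight_recl x : weight x = part x 0 + \sum_(i < m) part x i.+1.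
Proof. by rewrite /weight big_ord_recl. Qed.

Lemma strip_weight y x : strip y x -> weight y <= weight x.
Proof. by move/stripP=> xy; apply: leq_sum => i _; case: (xy i). Qed.

Section Toggle.

Variables mu nu : rowlens.
Let hi i := maxn (part mu i) (part nu i).
Let lo i := minn (part mu i) (part nu i).

Let up (j : nat) x := mk_shape (fun i =>
  if i is i'.+1 then lo i' + hi i - part x i' else hi 0 + j).
Let down x := mk_shape (fun i => lo i + hi i.+1 - part x i.+1).


Let hi_lo_sum : part mu m = 0 -> part nu m = 0 ->
  hi 0 + \sum_(i < m) hi i.+1 + \sum_(i < m) lo i = weight mu + weight nu.
Proof.
move=> mu0 nu0; rewrite -(big_ord_recl m (fun i : 'I_m.+1 => hi i)).
rewrite big_ord_recr /= {2}/hi mu0 nu0 addn0 !weight_sum_shift // -!big_split.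
by apply: eq_bigr => i _; rewrite /= /lo /hi; lia.
Qed.

Let in_up j k r : [&& strip mu r, strip nu r, weight r == k
    & part r 0 == hi 0 + j] -> k <= m ->
  [/\ part mu m = 0, part nu m = 0, part r 0 = hi 0 + j, weight r = k
    & forall i, hi i <= part r i /\ part r i.+1 <= lo i].
Proof.
case/and4P=> /stripP mu_r /stripP nu_r /eqP eq_k /eqP r0 le_km.
have rm : part r m = 0 by apply: (@part_last r mu); rewrite ?eq_k //; apply/stripP.
have [? _] := mu_r m; have [? _] := nu_r m.
split=> // [||i]; try by apply/eqP; rewrite -leqn0 -rm.
by have [? ?] := mu_r i; have [? ?] := nu_r i; rewrite /hi /lo; lia.
Qed.

Let in_down s : weight mu <= m -> weight nu <= m -> strip s mu -> strip s nu ->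
  [/\ part mu m = 0, part nu m = 0
    & forall i, part s i <= lo i /\ hi i.+1 <= part s i].
Proof.
move=> le_mu le_nu s_mu s_nu; rewrite (part_last _ s_mu) ?(part_last _ s_nu) //.
split=> // i; have [? ?] := stripP _ _ s_mu i; have [? ?] := stripP _ _ s_nu i.
by rewrite /hi /lo; lia.
Qed.

Let lo_le i : lo i <= m.
Proof. by have := part_le mu i; rewrite /lo; lia. Qed.

Let part_down r : (forall i, hi i <= part r i) ->
  forall i, part (down r) i = lo i + hi i.+1 - part r i.+1.
Proof.
move=> le_hi; apply: part_mk => i => [|lt_mi].
  by have := le_hi i.+1; have := lo_le i; lia.
by rewrite /lo /hi !part_out ?ltnS //; lia.
Qed.

Let part_up j s : part mu m = 0 -> hi 0 + j <= m ->
  (forall i, hi i.+1 <= part s i) ->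
  forall i, part (up j s) i
    = if i is i'.+1 then lo i' + hi i - part s i' else hi 0 + j.
Proof.
move=> mu0 le_hi0 le_hi; apply: part_mk => -[|i] // => [|lt_mi].
  by have := le_hi i; have := lo_le i; lia.
rewrite ltnS in lt_mi; have -> : lo i = 0.
  have [<-|ne_mi] := eqVneq m i; first by rewrite /lo mu0 min0n.
  by rewrite /lo part_out ?min0n // ltn_neqAle ne_mi.
by rewrite add0n /hi (part_out mu) // (part_out nu).
Qed.

(** A reflection preserves each sum [part s i + part r i.+1]; only the first part of [r] has no
    partner, and it alone accounts for the change of weight. *)
Let weight_toggle r s : part mu m = 0 -> part nu m = 0 ->
  (forall i, hi i <= part r i) -> (forall i, part r i.+1 <= lo i) ->
  (forall i, part s i = lo i + hi i.+1 - part r i.+1) ->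
  weight s + weight r + hi 0 = weight mu + weight nu + part r 0.
Proof.
move=> mu0 nu0 r_hi r_lo s_r.
have sm : part s m = 0 by rewrite s_r /lo /hi mu0 nu0 !(@part_out _ m.+1).
rewrite -hi_lo_sum // (weight_sum_shift sm) weight_recl.
suff: \sum_(i < m) part s i + \sum_(i < m) part r i.+1
    = \sum_(i < m) hi i.+1 + \sum_(i < m) lo i by lia.
rewrite -!big_split; apply: eq_bigr => i _; rewrite /= s_r.
by have := r_hi i.+1; have := r_lo i; lia.
Qed.

(* The common strip extensions of mu and nu and their common strip restrictions
   are matched by reflecting each part in the interval that the interlacing
   inequalities allot to it; only the first part of an extension is free. *)
Lemma card_toggle k l j :
  weight mu + k = weight nu + l -> weight mu + k <= m -> j <= k -> j <= l ->
  #|[set r | [&& strip mu r, strip nu r, weight r == weight mu + k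
             & part r 0 == hi 0 + j]]| =
  #|[set s | [&& strip s mu, strip s nu & weight mu == weight s + (l - j)]]|.
Proof.
move=> eq_w le_w le_jk le_jl.
have hi0_le : hi 0 + j <= m.
  by have := part_le_weight mu 0; have := part_le_weight nu 0; rewrite /hi; lia.
have down_ok r : r \in [set r | [&& strip mu r, strip nu r, weight r == weight mu + k
             & part r 0 == hi 0 + j]] ->
    down r \in [set s | [&& strip s mu, strip s nu & weight mu == weight s + (l - j)]]
      /\ up j (down r) = r.
  rewrite !inE => /in_up[//|mu0 nu0 r0 r_w r_P].
  have eq_d := part_down (fun i => (r_P i).1).
  have d_w := weight_toggle mu0 nu0 (fun i => (r_P i).1) (fun i => (r_P i).2) eq_d.
  have d_P i : part (down r) i <= lo i /\ hi i.+1 <= part (down r) i.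
    by have [? ?] := r_P i; have [? ?] := r_P i.+1; rewrite eq_d; lia.
  split.
    apply/and3P; split; last by apply/eqP; lia.
      by apply/stripP=> i; have := d_P i; rewrite /hi /lo; lia.
    by apply/stripP=> i; have := d_P i; rewrite /hi /lo; lia.
  apply: eq_shape => i; rewrite part_up //; last by move=> i'; case: (d_P i').
  case: i => [|i]; first by rewrite r0.
  by have [? ?] := r_P i; have [? ?] := r_P i.+1; rewrite eq_d; lia.
have up_ok s : s \in [set s | [&& strip s mu, strip s nu & weight mu == weight s + (l - j)]] ->
   up j s \in [set r | [&& strip mu r, strip nu r, weight r == weight mu + k
             & part r 0 == hi 0 + j]] /\ down (up j s) = s.
  rewrite !inE => /and3P[s_mu s_nu /eqP s_w].
  have [||mu0 nu0 s_P] := in_down _ _ s_mu s_nu; try lia.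
  have eq_u := part_up mu0 hi0_le (fun i => (s_P i).2).
  have u_P i : hi i <= part (up j s) i /\ part (up j s) i.+1 <= lo i.
    rewrite !eq_u; split; last by have := s_P i; lia.
    by case: i => [|i]; [lia | have := s_P i; lia].
  have s_u i : part s i = lo i + hi i.+1 - part (up j s) i.+1.
    by rewrite eq_u; have := s_P i; lia.
  have u_w := weight_toggle mu0 nu0 (fun i => (u_P i).1) (fun i => (u_P i).2) s_u.
  rewrite eq_u in u_w; split.
    apply/and4P; split; try by apply/eqP; rewrite ?eq_u; lia.
      by apply/stripP=> i; have := u_P i; rewrite /hi /lo; lia.
    by apply/stripP=> i; have := u_P i; rewrite /hi /lo; lia.
  by apply: eq_shape => i; rewrite part_down ?s_u // => i'; case: (u_P i').
by apply: (card_bij (f := down) (g := up j)) => x; first [case/down_ok | case/up_ok].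
Qed.

(** The commutation rule of adding a [k]-strip and removing an [l]-strip. The index [j] is the
    excess of the first row of [r] over the longer of the first rows of [mu] and [nu]. *)
Lemma card_commute k l : weight mu + k = weight nu + l -> weight mu + k <= m ->
  #|[set r | [&& strip mu r, strip nu r & weight r == weight mu + k]]| =
  \sum_(j < (minn k l).+1)
    #|[set s | [&& strip s mu, strip s nu & weight mu == weight s + (l - j)]]|.
Proof.
move=> eq_w le_w; rewrite -sum1_card.
rewrite (partition_big (fun r => inord (part r 0 - hi 0) : 'I_(minn k l).+1) predT) //=.
apply: eq_bigr => j _; have lt_j := ltn_ord j.
rewrite -(card_toggle (k := k) (l := l)) ?sum1_card //; try lia.
apply: eq_card => r; rewrite !inE unfold_in /= !inE -!andbA.
apply: andb_id2l => mu_r; apply: andb_id2l => nu_r; apply: andb_id2l => /eqP r_w.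
(* A strip puts into row 0 at most all of its boxes. Applied to [mu] and [nu] this bounds the excess
   by [k] and by [l], as [inordK] requires. *)
have le_r0 x : strip x r -> part r 0 + weight x <= part x 0 + weight r.
  move/stripP=> xr; suff: \sum_(i < m) part x i.+1 <= \sum_(i < m) part r i.+1.
    by rewrite !weight_recl; lia.
  by apply: leq_sum => i _; case: (xr i.+1).
have := le_r0 _ mu_r; have := le_r0 _ nu_r; have := stripP _ _ mu_r 0.
have := stripP _ _ nu_r 0 => -[? _] [? _] ? ?.
rewrite -val_eqE /= inordK; last by rewrite /hi; lia.
by apply/eqP/eqP; rewrite /hi; lia.
Qed.
End Toggle.


(** Chains of horizontal strips from the empty shape to [x], the head of [s] being the size of the
    outermost strip; in symmetric functions, the coefficient of the Schur function of [x] in the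
    product of the complete functions [h_k], [k] in [s]. *)
Fixpoint chains (s : seq nat) x : nat :=
  if s is k :: s' then
    \sum_(y : rowlens | strip y x && (weight x == weight y + k)) chains s' y
  else weight x == 0.

Lemma chains_weight s x : chains s x != 0 -> weight x = sumn s.
Proof.
elim: s x => [|k s IHs] x /=; first by rewrite eqb0 negbK => /eqP.
apply: contraNeq => ne_w; rewrite big1 // => y /andP[_ /eqP w_x].
apply/eqP; apply: contraNT ne_w => /IHs <-; rewrite w_x addnC //.
Qed.

Lemma weight0P x y : weight x = 0 -> weight y = 0 -> x = y.
Proof.
move=> x0 y0; apply: eq_shape => i.
by have := part_le_weight x i; have := part_le_weight y i; lia.
Qed.

End Strips.

(** * Sums over chains and matrices with given margins *)

Fixpoint bounded_seqs (l : seq nat) (k : nat) : seq (seq nat) :=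
  if l is b :: l' then
    [seq j :: t | j <- iota 0 (minn k b).+1, t <- bounded_seqs l' (k - j)]
  else if k == 0 then [:: [::]] else [::].

Lemma bounded_seqs_cons b l k : bounded_seqs (b :: l) k =
  [seq j :: t | j <- index_iota 0 (minn k b).+1, t <- bounded_seqs l (k - j)].
Proof. by []. Qed.

Definition subs (l j : seq nat) := [seq p.1 - p.2 | p <- zip l j].

Fixpoint margin_mxs (rs c : seq nat) : seq (seq (seq nat)) :=
  if rs is k :: rs' then
    [seq j :: A | j <- bounded_seqs c k, A <- margin_mxs rs' (subs c j)]
  else if sumn c == 0 then [:: [::]] else [::].

Section ChainSums.
Variable m : nat.
Implicit Types x y z : rowlens m.

(** The adjoint of multiplication by [h_k], applied to a product of complete functions. By
    [card_commute] a shape [y] above [x] and the next shape [z] of the chain is traded for a shape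
    [s] below both; the [j] boxes by which the strip of size [b] shrinks form one entry of the
    sequence, and the remaining [k - j] are passed on to [z]. *)
Lemma sum_chains_strip l k x : weight x + k <= m ->
  \sum_(y : rowlens m | strip x y && (weight y == weight x + k)) chains l y
    = \sum_(j <- bounded_seqs l k) chains (subs l j) x.
Proof.
elim: l k x => [|b l IHl] k x le_w.
  have [/eqP|w_gt0] := posnP (weight x + k).
    rewrite addn_eq0 => /andP[/eqP x0 /eqP ->]; rewrite big_seq1 /= x0 (bigD1 x) /=.
      by rewrite x0 big1 // => y /andP[/andP[_ /eqP y0]]; rewrite (weight0P y0 x0) eqxx.
    by rewrite x0 eqxx andbT; apply/stripP=> i; have := part_le_weight x i;
       have := part_le_weight x i.+1; lia.
  rewrite big1 => [|y /andP[_ /eqP /= ->]]; last by rewrite eqn0Ngt w_gt0.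
  by case: k w_gt0 {le_w} => [|k]; rewrite ?big_nil // addn0 big_seq1 /= eqn0Ngt => ->.
pose B j s := strip s x && (weight x == weight s + (b - j)).
transitivity (\sum_(j < (minn k b).+1) \sum_(s | B j s)
    \sum_(z | strip s z && (weight z == weight s + (k - j))) chains l z).
  transitivity (\sum_z \sum_(y | [&& strip x y, strip z y & weight y == weight x + k]
      && (weight x + k == weight z + b)) chains l z).
    rewrite (exchange_big_dep predT) //=; apply: eq_bigr => z _; apply: eq_bigl => y.
    by rewrite -!andbA; do 1!bool_congr; rewrite andbCA; do 1!bool_congr;
       case: eqP => // ->.
  rewrite (eq_bigr (fun j : 'I_ _ => \sum_z \sum_(s | [&& B j s, strip s z &
     weight z == weight s + (k - j)]) chains l z)); last first.
    by move=> j _; rewrite (exchange_big_dep predT) //=.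
  rewrite exchange_big /=; apply: eq_bigr => z _.
  have [eq_w|ne_w] := eqVneq (weight x + k) (weight z + b); last first.
    rewrite big_pred0 => [|y]; last by rewrite andbF.
    rewrite big1 // => j _; rewrite big_pred0 // => s; apply/and3P=> -[].
    case/andP=> _ /eqP w_x _ /eqP w_z; case/eqP: ne_w; have := ltn_ord j.
    by rewrite w_x w_z; lia.
  rewrite (eq_bigl (fun y => y \in [set y | [&& strip x y, strip z y & weight y == weight x + k]]));
    last by move=> y; rewrite inE andbT.
  rewrite sum_nat_const (card_commute eq_w) // big_distrl /=; apply: eq_bigr => j _.
  rewrite -sum_nat_const; apply: eq_bigl => s; rewrite inE -andbA.
  case: (strip s x) => //=; case: (strip s z); rewrite /= ?andbF //.
  by apply/idP/idP => [/eqP w|/andP[/eqP w _]]; [apply/andP; split|]; apply/eqP;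
     have := ltn_ord j; lia.
rewrite bounded_seqs_cons big_allpairs_dep big_mkord.
apply: eq_bigr => j _; rewrite exchange_big /=; apply: eq_bigr => s /andP[s_x /eqP w_x].
by apply: IHl; have := ltn_ord j; have := strip_weight s_x; lia.
Qed.

Lemma chains0 s x : weight x = 0 -> chains s x = (sumn s == 0).
Proof.
elim: s x => [|k s IHs] x x0 /=; first by rewrite x0.
case: k => [|k]; last first.
  by rewrite big_pred0 // => y; rewrite x0 addnS andbF.
rewrite (big_pred1 x) ?IHs // => y; rewrite x0 addn0 eq_sym /=.
apply/andP/eqP => [[_ /eqP y0]|->]; first exact: weight0P.
rewrite x0; split=> //; apply/stripP=> i.
by have := part_le_weight x i; have := part_le_weight x i.+1; lia.
Qed.

(** The outermost strip of the first chain is pushed into the second one by [sum_chains_strip]. The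
    sequence [j] that results is the first row of the matrix, and [subs ka j] are the column sums
    left for the other rows. *)
Lemma sum_chains2 la ka : sumn la <= m ->
  \sum_(x : rowlens m) chains la x * chains ka x = size (margin_mxs la ka).
Proof.
elim: la ka => [|k la IHla] ka /= le_m.
  have w0: weight (mk_shape m (fun=> 0)) = 0.
    by rewrite /weight big1 // => i _; rewrite part_mk.
  rewrite (bigD1 (mk_shape m (fun=> 0))) //= w0 mul1n chains0 // big1 => [|x ne_x].
    by case: eqP.
  by case: eqP => // x0; rewrite (weight0P x0 w0) eqxx in ne_x.
rewrite size_allpairs_dep sumnE big_map.
rewrite (eq_bigr (fun j => \sum_(x : rowlens m) chains la x * chains (subs ka j) x));
  last by move=> j _; rewrite IHla //; apply: leq_trans le_m; apply: leq_addl.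
rewrite [RHS]exchange_big /=; transitivity (\sum_(x : rowlens m) \sum_(y | strip y x && (weight x == weight y + k))
    chains la y * chains ka x); first by apply: eq_bigr => x _; rewrite big_distrl.
rewrite (exchange_big_dep predT) //=; apply: eq_bigr => y _; rewrite -!big_distrr /=.
(* A nonzero number of chains fixes the weight of [y], which keeps the extended shapes inside the
   box. *)
have [->|nz] := eqVneq (chains la y) 0; first by rewrite !mul0n.
congr (_ * _); apply: sum_chains_strip.
by rewrite (chains_weight nz) addnC.
Qed.

End ChainSums.

Lemma bounded_seqsP l k j :
  reflect [/\ size j = size l, sumn j = k & forall i, nth 0 j i <= nth 0 l i]
          (j \in bounded_seqs l k).
Proof.
elim: l k j => [|b l IHl] k j.
  apply: (iffP idP) => [|[/size0nil-> <- _]] //=.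
  by rewrite /bounded_seqs; case: eqP => // -> /[!inE]/eqP->.
rewrite bounded_seqs_cons; apply: (iffP allpairsPdep) => [[a [t [a_in /IHl[t_l t_k t_le] ->]]]|].
  rewrite mem_index_iota in a_in; split=> [||[|i]] //=; rewrite ?t_l ?t_k //; try lia.
case: j => [|a t] [] //= [t_l] t_k t_le; exists a, t.
rewrite mem_index_iota; split=> //; first by have := t_le 0; simpl; lia.
by apply/IHl; split=> // [|i]; [lia | exact: (t_le i.+1)].
Qed.

Lemma bounded_seqs_uniq l k : uniq (bounded_seqs l k).
Proof.
elim: l k => [|b l IHl] k; first by rewrite /=; case: eqP.
rewrite bounded_seqs_cons; apply: allpairs_uniq_dep => //; first exact: iota_uniq.
by move=> [a t] [a' t'] _ _ /= [-> ->].
Qed.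

Lemma margin_mxsP rs c A :
  reflect [/\ map sumn A = rs, {in A, forall r, size r = size c}
            & forall i, \sum_(r <- A) nth 0 r i = nth 0 c i]
          (A \in margin_mxs rs c).
Proof.
have nth_subs u j i : size u = size j -> nth 0 (subs u j) i = nth 0 u i - nth 0 j i.
  move=> sz; have [lt_i|le_i] := ltnP i (size j).
    by rewrite (nth_map (0, 0)) ?nth_zip // size_zip sz minnn.
  by rewrite !nth_default // ?size_map ?size_zip sz ?minnn.
elim: rs c A => [|k rs IHrs] c A.
  apply: (iffP idP) => [|[A0 _ c0]]; last case: A A0 c0 => // _ c0.
    rewrite /=; case: eqP => // c0 /[!inE]/eqP->; split=> // i; rewrite big_nil.
    have [le_i|lt_i] := leqP (size c) i; first by rewrite nth_default.
    have := c0; rewrite sumnE => /eqP; rewrite sum_nat_seq_eq0 => /allP/(_ (nth 0 c i)).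
    by rewrite mem_nth // => /(_ isT)/eqP.
  rewrite /= (_ : sumn c = 0) //; rewrite sumnE big1_seq // => a /andP[_ /(nthP 0)[i _ <-]].
  by rewrite -c0 big_nil.
rewrite /=; apply: (iffP allpairsPdep) => [[j [B [/bounded_seqsP[j_c j_k j_le]]]]|].
  case/IHrs=> B_rs B_c B_sum ->; have sz : size (subs c j) = size c.
    by rewrite size_map size_zip j_c minnn.
  rewrite /= j_k B_rs; split=> // [r|i]; first by rewrite inE => /predU1P[->|/B_c->].
  by rewrite big_cons B_sum nth_subs //; have := j_le i; lia.
case: A => [|j B] [] //= [j_k B_rs] B_c B_sum; exists j, B.
have j_c : size j = size c by apply: B_c; rewrite inE eqxx.
split=> //; first by apply/bounded_seqsP; split=> // i; rewrite -B_sum big_cons leq_addr.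
apply/IHrs; split=> // [r B_r|i].
  by rewrite size_map size_zip j_c minnn B_c // inE B_r orbT.
by rewrite nth_subs // -B_sum big_cons addKn.
Qed.

Lemma margin_mxs_uniq rs c : uniq (margin_mxs rs c).
Proof.
elim: rs c => [|k rs IHrs] c; first by rewrite /=; case: eqP.
apply: allpairs_uniq_dep => //; first exact: bounded_seqs_uniq.
by move=> [a t] [a' t'] _ _ /= [-> ->].
Qed.

(** * Semistandard tableaux as chains of shapes *)

Section Cells.
Variable mu : seq nat.

(** Partial inverse of the coordinates; it allows tableaux to be handled as functions on pairs of
    naturals instead of on a dependent type. *)
Definition cell_at (r c : nat) : option (cell mu) :=
  obind (fun r' : 'I_(size mu) =>
      omap (fun c' => Tagged (fun i : 'I_(size mu) => 'I_(nth 0 mu i)) c')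
           (insub c : option 'I_(nth 0 mu r')))
    (insub r : option 'I_(size mu)).

Lemma cell_atK (x : cell mu) : cell_at (cell_row x) (cell_col x) = Some x.
Proof. by case: x => r c; rewrite /cell_at /cell_row /cell_col /= !valK /= valK. Qed.

Lemma cell_col_lt (x : cell mu) : cell_col x < nth 0 mu (cell_row x).
Proof. by case: x => r c; rewrite /cell_row /cell_col /= ltn_ord. Qed.

Variant cell_at_spec r c : option (cell mu) -> Prop :=
| CellIn (x : cell mu) of cell_row x = r & cell_col x = c & c < nth 0 mu r :
    cell_at_spec r c (Some x)
| CellOut of nth 0 mu r <= c : cell_at_spec r c None.

Lemma cell_atP r c : cell_at_spec r c (cell_at r c).
Proof.
have [lt_c|le_c] := ltnP c (nth 0 mu r).
  have lt_r : r < size mu.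
    by rewrite ltnNge; apply: contraL lt_c => le_r; rewrite nth_default.
  pose x : cell mu := Tagged (fun i : 'I_(size mu) => 'I_(nth 0 mu i))
                (Ordinal lt_c : 'I_(nth 0 mu (Ordinal lt_r))).
  by rewrite -[r in cell_at r]/(cell_row x) -[c in cell_at _ c]/(cell_col x)
    cell_atK; constructor.
suff -> : cell_at r c = None by constructor.
rewrite /cell_at; case: insubP => //= r' _ r'_r.
by rewrite insubF // r'_r ltnNge le_c.
Qed.

Lemma card_cells (P : nat -> nat -> bool) :
  #|[set x : cell mu | P (cell_row x) (cell_col x)]|
    = \sum_(r < size mu) \sum_(c < nth 0 mu r) P r c.
Proof.
rewrite -sum1dep_card big_mkcond /=.
rewrite (sig_big_dep xpredT (fun=> xpredT) (fun (i : 'I_(size mu)) (j : 'I_(nth 0 mu i)) => P i j : nat)).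
by apply: eq_bigr => x _; rewrite /cell_row /cell_col; case: (P _ _).
Qed.

End Cells.

(** The true values of [p] form an initial segment, so their number is the first place where [p]
    fails. This turns a count of boxes in a row into a row length. *)
Lemma count_down_closed (p : pred nat) n c :
  (forall i, p i.+1 -> p i) -> (forall i, p i -> i < n) ->
  (c < \sum_(i < n) p i) = p c.
Proof.
move=> p_down p_lt; have p_le i j : i <= j -> p j -> p i.
  by move=> le_ij; rewrite -(subnKC le_ij); elim: (j - i) => [|d IHd];
     rewrite ?addn0 // addnS => /p_down.
rewrite -(big_mkord xpredT (fun i => p i : nat)).
have [p_c|np_c] := boolP (p c).
  rewrite (big_cat_nat (n := c.+1)) ?p_lt //=; apply: leq_trans (leq_addr _ _).
  rewrite (eq_big_nat _ _ (F2 := fun=> 1)) ?sum_nat_const_nat ?muln1 // => i /andP[_].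
  by rewrite ltnS => /p_le-/(_ p_c) ->.
have [le_nc|lt_cn] := leqP n c.
  rewrite ltnNge; apply/negbF; apply: leq_trans le_nc.
  rewrite -[X in _ <= X]muln1 -[X in _ <= X * _]subn0 -sum_nat_const_nat.
  by apply: leq_sum => i _; case: (p i).
rewrite (big_cat_nat (n := c)) ?(ltnW lt_cn) //= [X in _ + X]big_nat_cond [X in _ + X]big1.
  rewrite addn0 ltnNge; apply/negbF; rewrite -[X in _ <= X]muln1 -[X in _ <= X * _]subn0.
  by rewrite -sum_nat_const_nat; apply: leq_sum => i _; case: (p i).
move=> i /andP[/andP[le_ci _] _]; apply/eqP; rewrite eqb0.
by apply: contra np_c; apply: p_le.
Qed.

(* Tableaux with entries below l and f k entries k; Kostka is the case
   l = size la, f = nth 0 la. *)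
Definition ssyts (l : nat) (mu : seq nat) (f : nat -> nat) :
    {set {ffun cell mu -> 'I_l}} :=
  [set T : {ffun cell mu -> 'I_l} | [&& [forall x : cell mu, forall y : cell mu,
         (cell_row x == cell_row y) && (cell_col x < cell_col y)
           ==> (T x <= T y)],
      [forall x : cell mu, forall y : cell mu,
         (cell_col x == cell_col y) && (cell_row x < cell_row y)
           ==> (T x < T y)]
    & [forall k : 'I_l, #|[set x : cell mu | T x == k]| == f k]]].

Lemma Kostka_ssyts mu la : Kostka mu la = #|ssyts (size la) mu (nth 0 la)|.
Proof. by []. Qed.

Section Entry.
Variables (l : nat) (mu : seq nat).
Implicit Type T : {ffun cell mu -> 'I_l}.

(* Boxes outside the diagram get the value l. *)
Definition entry T r c : nat := oapp (fun x => T x : nat) l (cell_at mu r c).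

Lemma entry_le T r c : entry T r c <= l.
Proof. by rewrite /entry; case: cell_at => //= x; apply: ltnW. Qed.

Lemma entry_lt T r c : (entry T r c < l) = (c < nth 0 mu r).
Proof.
by rewrite /entry; case: cell_atP => [x _ _ ->|le_c] /=; rewrite ?ltn_ord // ltnn ltnNge le_c.
Qed.

Lemma entry_cell T (x : cell mu) : entry T (cell_row x) (cell_col x) = T x.
Proof. by rewrite /entry cell_atK. Qed.

Lemma entry_inj T T' : (forall r c, entry T r c = entry T' r c) -> T = T'.
Proof. by move=> eqT; apply/ffunP=> x; apply/val_inj; rewrite /= -!entry_cell eqT. Qed.

Lemma entry_realize (V : nat -> nat -> nat) :
  (forall r c, V r c <= l) -> (forall r c, (V r c < l) = (c < nth 0 mu r)) ->
  exists T, forall r c, entry T r c = V r c.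
Proof.
move=> V_le V_lt.
have Vx (x : cell mu) : V (cell_row x) (cell_col x) < l by rewrite V_lt cell_col_lt.
exists [ffun x => Ordinal (Vx x)] => r c; rewrite /entry.
case: cell_atP => [x <- <- _ | le_c] /=; first by rewrite ffunE.
by apply/eqP; rewrite eqn_leq V_le leqNgt V_lt ltnNge le_c.
Qed.

Variables (m : nat) (f : nat -> nat).
Hypothesis mu_dec : forall r, nth 0 mu r.+1 <= nth 0 mu r.
Hypothesis mu_le : forall r, nth 0 mu r <= m.
Hypothesis mu_out : forall r, m < r -> nth 0 mu r = 0.

Lemma card_entry T k : k < l ->
  #|[set x | T x == k :> nat]| = \sum_(r < m.+1) \sum_(c < m) (entry T r c == k).
Proof.
move=> lt_k; have -> : [set x | T x == k :> nat]
    = [set x | entry T (cell_row x) (cell_col x) == k].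
  by apply/setP=> x; rewrite !inE entry_cell.
rewrite (card_cells mu (fun r c => entry T r c == k)).
have out r c : nth 0 mu r <= c -> (entry T r c == k) = false.
  move=> le_c; apply/negbTE; apply: contraTneq le_c => e_k.
  by rewrite -ltnNge -(entry_lt T) e_k.
have row_sum r : \sum_(c < nth 0 mu r) (entry T r c == k) = \sum_(c < m) (entry T r c == k).
  rewrite (big_ord_widen m (fun c => entry T r c == k : nat)) //.
  by rewrite big_mkcond; apply: eq_bigr => c _; case: ltnP => // /out->.
transitivity (\sum_(r < size mu) \sum_(c < m) (entry T r c == k)).
  by apply: eq_bigr => r _.
have zero r : nth 0 mu r = 0 -> \sum_(c < m) (entry T r c == k) = 0.
  by move=> r0; rewrite big1 // => c _; rewrite out ?r0.
rewrite (big_ord_widen (size mu + m.+1) (fun r => \sum_(c < m) (entry T r c == k))) ?leq_addr //.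
rewrite [RHS](big_ord_widen (size mu + m.+1) (fun r => \sum_(c < m) (entry T r c == k))) ?leq_addl //.
rewrite big_mkcond [RHS]big_mkcond; apply: eq_bigr => r _ /=.
case: ltnP => le_r; case: ltnP => lt_r //; rewrite zero //; first exact: mu_out.
by rewrite nth_default.
Qed.

(** Comparing neighbours suffices because the diagram is decreasing. With the value [l] outside the
    diagram the row condition holds across the border without a guard, while strictness down a
    column has to be restricted to boxes. *)
Lemma ssytsP T :
  reflect [/\ forall r c, entry T r c <= entry T r c.+1,
     forall r c, entry T r.+1 c < l -> entry T r c < entry T r.+1 c
   & forall k, k < l -> \sum_(r < m.+1) \sum_(c < m) (entry T r c == k) = f k]
    (T \in ssyts l mu f).
Proof.
rewrite inE; apply: (iffP and3P) => [[rowT colT cT]|[rowT colT cT]].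
  split=> [r c|r c|k lt_k].
  - have [lt_c|le_c] := ltnP c.+1 (nth 0 mu r); last first.
      by apply: leq_trans (entry_le _ _ _) _; rewrite leqNgt entry_lt -leqNgt.
    rewrite /entry; case: cell_atP => [x xr xc _|]; last by lia.
    case: cell_atP => [y yr yc _|]; last by lia.
    have /forallP/(_ x)/forallP/(_ y)/implyP := rowT; apply.
    by rewrite xr yr xc yc eqxx /=.
  - rewrite entry_lt => lt_c; have := mu_dec r.
    rewrite /entry; case: cell_atP => [x xr xc _|]; last by lia.
    case: cell_atP => [y yr yc _ _|]; last by lia.
    have /forallP/(_ x)/forallP/(_ y)/implyP := colT; apply.
    by rewrite xr yr xc yc eqxx /=.
  - by rewrite -card_entry //; apply/eqP/(forallP cT (Ordinal lt_k)).
have rowT' r c d : entry T r c <= entry T r (c + d).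
  by elim: d => [|d IHd]; rewrite ?addn0 // addnS (leq_trans IHd).
have colT' r c d : entry T (r + d.+1) c < l -> entry T r c < entry T (r + d.+1) c.
  elim: d => [|d IHd]; first by rewrite addn1; apply: colT.
  rewrite addnS => lt_d; have := colT _ _ lt_d; move: lt_d IHd; lia.
split.
- apply/forallP=> x; apply/forallP=> y; apply/implyP=> /andP[/eqP eq_r /ltnW le_c].
  by rewrite -!entry_cell eq_r -(subnKC le_c).
- apply/forallP=> x; apply/forallP=> y; apply/implyP=> /andP[/eqP eq_c lt_r].
  have := ltn_ord (T y); rewrite -!entry_cell eq_c -(subnKC lt_r) addSnnS.
  exact: colT'.
- by apply/forallP=> k; apply/eqP; rewrite -cT // -card_entry.
Qed.
End Entry.

Section KostkaChains.
Variables (m : nat) (f : nat -> nat).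

Definition rows_of (y : rowlens m) : seq nat := mkseq (part y) m.+1.

Lemma nth_rows_of y r : nth 0 (rows_of y) r = part y r.
Proof.
have [lt_r|le_r] := ltnP r m.+1; first exact: nth_mkseq.
by rewrite part_out // nth_default ?size_mkseq.
Qed.

Definition is_shape (mu : seq nat) :=
  [/\ forall r, nth 0 mu r.+1 <= nth 0 mu r, forall r, nth 0 mu r <= m
    & forall r, m < r -> nth 0 mu r = 0].

Lemma part_mk_nth mu r : is_shape mu -> part (mk_shape m (nth 0 mu)) r = nth 0 mu r.
Proof. by case=> _ mu_le mu_out; rewrite part_mk. Qed.

Lemma rows_of_shape y x : strip y x -> is_shape (rows_of y).
Proof.
move/stripP=> xy; split=> r; rewrite !nth_rows_of; last exact: part_out.
  by have := xy r; have := xy r.+1; lia.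
exact: part_le.
Qed.

Lemma sum_ltn a : a <= m -> \sum_(c < m) (c < a) = a.
Proof.
move=> le_a; rewrite -[RHS]muln1 -[X in X * _]card_ord -sum_nat_const.
rewrite (big_ord_widen m (fun=> 1)) // [RHS]big_mkcond.
by apply: eq_bigr => c _; case: ltnP.
Qed.

Section Step.
Variables (l : nat) (mu : seq nat).
Hypothesis mu_shape : is_shape mu.
Let x := mk_shape m (nth 0 mu).

Definition inner (T : {ffun cell mu -> 'I_l.+1}) : rowlens m :=
  mk_shape m (fun r => \sum_(c < m) (entry T r c < l)).

Lemma part_inner T r : part (inner T) r = \sum_(c < m) (entry T r c < l).
Proof.
have [_ _ mu_out] := mu_shape.
rewrite part_mk // => {r} r => [|/mu_out r0].
  apply: leq_trans (leq_sum _ (fun i _ => leq_b1 _)) _.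
  by rewrite sum1_card card_ord.
rewrite big1 // => i _; apply/eqP; rewrite eqb0 -leqNgt.
by have := entry_lt T r i; rewrite r0 ltn0 => /negbT; rewrite -leqNgt; apply: ltnW.
Qed.

Lemma inner_lt T : T \in ssyts l.+1 mu f ->
  forall r c, (c < part (inner T) r) = (entry T r c < l).
Proof.
have [mu_dec mu_le mu_out] := mu_shape.
case/(ssytsP f mu_dec mu_le mu_out)=> rowT _ _ r c; rewrite part_inner.
rewrite (count_down_closed (p := fun c => entry T r c < l)) // => {}c.
  by apply: leq_ltn_trans.
by move=> lt_l; apply: leq_trans (mu_le r); rewrite -(entry_lt T); apply: ltnW.
Qed.

(** Two entries [l] in one column would contradict strictness, so the boxes holding the largest
    entry form a horizontal strip. *)
Lemma inner_strip T : T \in ssyts l.+1 mu f ->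
  strip (inner T) x && (weight x == weight (inner T) + f l).
Proof.
move=> ssT; have in_lt := inner_lt ssT; have [mu_dec mu_le mu_out] := mu_shape.
have [rowT colT cT] := ssytsP f mu_dec mu_le mu_out _ ssT.
have px r : part x r = nth 0 mu r by apply: part_mk_nth.
apply/andP; split.
  apply/stripP=> r; rewrite !px; split; rewrite leqNgt; apply/negP.
    rewrite in_lt => lt_e; have := entry_lt T r (nth 0 mu r).
    by rewrite ltnn => /negP; apply; apply: ltnW.
  move=> lt_r; have := in_lt r (part (inner T) r); rewrite ltnn => /esym/negP; apply.
  rewrite -(entry_lt T) in lt_r; have := colT _ _ lt_r.
  by move: lt_r; rewrite ltnS => le_l lt_e; apply: leq_trans lt_e le_l.
rewrite -cT // /weight -big_split /=; apply/eqP/eq_bigr=> r _.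
rewrite part_inner px -big_split /=.
rewrite -[LHS]sum_ltn //; apply: eq_bigr => c _.
by rewrite -(entry_lt T) ltnS; have [] := ltngtP (entry T r c) l.
Qed.

(** Outside [rows_of y] the default value of [entry] is [l], which is exactly the entry that the
    added boxes must receive. *)
Let fill y (T : {ffun cell (rows_of y) -> 'I_l}) : {ffun cell mu -> 'I_l.+1} :=
  [ffun b => inord (entry T (cell_row b) (cell_col b))].

Lemma entry_fill y T r c : entry (@fill y T) r c =
  if c < nth 0 mu r then entry T r c else l.+1.
Proof.
rewrite {1}/entry; case: cell_atP => [b <- <- ->|le_c] /=; last by rewrite ltnNge le_c.
by rewrite ffunE inordK // ltnS entry_le.
Qed.

Lemma card_inner y : strip y x -> weight x = weight y + f l ->
  #|[set T in ssyts l.+1 mu f | inner T == y]| = #|ssyts l (rows_of y) f|.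
Proof.
move=> y_x w_x; have [mu_dec mu_le mu_out] := mu_shape.
have [y_dec y_le y_out] := rows_of_shape y_x.
have px r : part x r = nth 0 mu r by apply: part_mk_nth.
have y_mu r c : c < part y r -> c < nth 0 mu r.
  by move=> lt_c; apply: leq_trans lt_c _; rewrite -px; case: (stripP _ _ y_x r).
have fillE T r c : entry (@fill y T) r c =
    if c < part y r then entry T r c else if c < nth 0 mu r then l else l.+1.
  rewrite entry_fill; have := entry_lt T r c; rewrite nth_rows_of => lt_e.
  have := entry_le T r c; have := y_mu r c.
  by case: ifP => lt_x; case: ifP => lt_y; lia.
have fill_inj : injective (@fill y).
  move=> T T' eqT; apply: entry_inj => r c.
  have := congr1 (fun U => entry U r c) eqT; rewrite !fillE.
  have := entry_lt T r c; have := entry_lt T' r c; rewrite nth_rows_of.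
  have := entry_le T r c; have := entry_le T' r c.
  by case: ifP => // _; lia.
rewrite -(card_imset _ fill_inj); apply: eq_card => T; rewrite inE.
apply/andP/imsetP=> [[ssT /eqP inT]|[T' ssT' ->]].
  have in_lt := inner_lt ssT; rewrite inT in in_lt.
  have [rowT colT cT] := ssytsP f mu_dec mu_le mu_out _ ssT.
  (* Truncation at [l] merges the removed boxes, with entry [l], and the outside of [mu], with value
     [l.+1], into the outside of the smaller tableau. *)
  have [||T' eqT'] := @entry_realize l (rows_of y) (fun r c => minn (entry T r c) l).
  - by move=> r c; apply: geq_minr.
  - by move=> r c; rewrite nth_rows_of in_lt; lia.
  exists T'; last first.
    apply: entry_inj => r c; rewrite fillE eqT' in_lt -(entry_lt T).
    by have := entry_le T r c; case: ifP => [|] ?; [|case: ifP]; lia.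
  apply/(ssytsP f y_dec y_le y_out); split=> [r c|r c|k lt_k].
  - by rewrite !eqT'; have := rowT r c; lia.
  - by rewrite !eqT'; have := colT r c; lia.
  - rewrite -cT; last by lia.
    by do 2![apply: eq_bigr => ? _]; rewrite eqT'; congr nat_of_bool; apply/eqP/eqP; lia.
have [rowT colT cT] := ssytsP f y_dec y_le y_out _ ssT'.
have lt_y r c : (entry T' r c < l) = (c < part y r) by rewrite entry_lt nth_rows_of.
have lt_l r c : (entry (@fill y T') r c < l) = (c < part y r).
  rewrite fillE; case: ifP => [<-|_] //; case: ifP; lia.
split.
  apply/(ssytsP f mu_dec mu_le mu_out); split=> [r c|r c|k lt_k].
  - rewrite !fillE; have := rowT r c; have := lt_y r c; have := lt_y r c.+1.
    have := mu_dec r; have := y_mu r c; have := y_mu r c.+1.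
    by do 4?[case: ifP => ?]; lia.
  - rewrite !fillE; have := colT r c; have := lt_y r c; have := lt_y r.+1 c.
    have [le_y le_x] := stripP _ _ y_x r; rewrite px in le_x; have := mu_dec r.
    by do 4?[case: ifP => ?]; lia.
  move: lt_k; rewrite ltnS leq_eqVlt => /predU1P[->|lt_k].
    (* The entries equal to [l] are counted as the difference of the two weights. *)
    apply/eqP; rewrite -(eqn_add2l (weight y)) -w_x /weight -big_split /=.
    apply/eqP; apply: eq_bigr => r _; rewrite px -(sum_ltn (part_le y r)).
    rewrite -big_split -[RHS]sum_ltn //=; apply: eq_bigr => c _; rewrite fillE.
    by have := lt_y r c; have := y_mu r c; do 2?[case: ifP => ?]; lia.
  rewrite -(cT k) //; apply: eq_bigr => r _; apply: eq_bigr => c _.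
  rewrite fillE; congr nat_of_bool.
  by have := lt_y r c; do 2?[case: ifP => ?]; lia.
apply/eqP/eq_shape=> r; rewrite part_inner -[RHS]sum_ltn ?part_le //.
by apply: eq_bigr => c _; rewrite lt_l.
Qed.

Lemma card_ssyts_step : #|ssyts l.+1 mu f| =
  \sum_(y | strip y x && (weight x == weight y + f l)) #|ssyts l (rows_of y) f|.
Proof.
rewrite -sum1_card (partition_big inner (fun y => strip y x && (weight x == weight y + f l)));
  last exact: inner_strip.
apply: eq_bigr => y /andP[y_x /eqP w_x]; rewrite -card_inner // -sum1_card.
by apply: eq_bigl => T; rewrite !inE.
Qed.

End Step.

(** Deleting the boxes with the largest entry peels off the outermost strip. Chains list this strip
    first, whence the reversal of the content. *)
Lemma card_ssyts l mu : is_shape mu ->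
  #|ssyts l mu f| = chains (rev (mkseq f l)) (mk_shape m (nth 0 mu)).
Proof.
elim: l mu => [|l IHl] mu mu_shape.
  have [mu_dec mu_le mu_out] := mu_shape.
  rewrite /= /weight (eq_bigr (fun r : 'I__ => nth 0 mu r)); last first.
    by move=> r _; rewrite part_mk_nth.
  rewrite sum_nat_eq0; case: forallP => [mu0|mu_n0] /=.
    have nth0 r : nth 0 mu r = 0.
      have [lt_r|/mu_out//] := ltnP r m.+1; exact/eqP/(mu0 (Ordinal lt_r)).
    have [||T T0] := @entry_realize 0 mu (fun _ _ => 0) => // [r c|].
      by rewrite nth0 ltn0.
    apply/eqP/cards1P; exists T; apply/setP=> T'; rewrite inE.
    apply/idP/eqP=> [_|->].
      by apply: entry_inj => r c; rewrite T0; apply/eqP; rewrite -leqn0 entry_le.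
    by apply/(ssytsP f mu_dec mu_le mu_out); split=> // r c; rewrite !T0.
  apply/eqP; rewrite cards_eq0 -subset0; apply/subsetP=> T _; case: mu_n0 => r.
  rewrite -leqn0 leqNgt; apply/negP=> lt_r.
  by have := entry_lt T r 0; rewrite lt_r.
rewrite card_ssyts_step // mkseqS rev_rcons /=; apply: eq_bigr => y /andP[y_x _].
rewrite (IHl _ (rows_of_shape y_x)); congr chains.
by apply: eq_shape => r; rewrite part_mk_nth ?nth_rows_of //; apply: rows_of_shape y_x.
Qed.

End KostkaChains.

(** * Unitriangularity for the dominance order *)

Section ChainsTriangular.
Variable m : nat.
Implicit Types x y : rowlens m.

(** A horizontal strip adds at most one nonempty row. *)
Lemma chains_height s x : chains s x != 0 -> forall r, size s <= r -> part x r = 0.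
Proof.
elim: s x => [|k s IHs] x /=.
  by rewrite eqb0 negbK => /eqP x0 r _; have := part_le_weight x r; lia.
rewrite sum_nat_eq0 => /forallPn[y]; rewrite negb_imply => /andP[/andP[/stripP y_x _] nz].
by case=> // r le_r; have := IHs y nz r le_r; have := y_x r; lia.
Qed.

Lemma chains_dec s x : chains s x != 0 -> forall r, part x r.+1 <= part x r.
Proof.
case: s => [|k s] /=.
  by rewrite eqb0 negbK => /eqP x0 r; have := part_le_weight x r.+1; lia.
rewrite sum_nat_eq0 => /forallPn[y]; rewrite negb_imply => /andP[/andP[/stripP y_x _] _] r.
by have := y_x r; lia.
Qed.

(** After the inner steps [s] the shape has at most [size s] rows, so all of its weight [sumn s]
    lies there; the strips of [u] can only lengthen these rows. *)
Lemma chains_dominated u s x :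
  chains (u ++ s) x != 0 -> sumn s <= \sum_(r < size s) part x r.
Proof.
elim: u x => [|k u IHu] x /=.
  move=> nz; rewrite -(chains_weight nz) /weight.
  rewrite -(big_mkord xpredT (part x)) -(big_mkord xpredT (part x)).
  have [le_s|lt_s] := leqP m.+1 (size s).
    by rewrite [X in _ <= X](big_cat_nat (n := m.+1)) //= leq_addr.
  rewrite (big_cat_nat (n := size s)) ?(ltnW lt_s) //= [X in _ + X]big_nat_cond.
  by rewrite [X in _ + X]big1 ?addn0 // => r /andP[/andP[le_r _] _]; apply: (chains_height nz).
rewrite sum_nat_eq0 => /forallPn[y]; rewrite negb_imply => /andP[/andP[/stripP y_x _] nz].
by apply: leq_trans (IHu y nz) _; apply: leq_sum => r _; case: (y_x r).
Qed.

Lemma weight_nth t x : (forall r, part x r = nth 0 t r) -> size t <= m.+1 ->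
  weight x = sumn t.
Proof.
move=> x_t le_t; rewrite sumnE (big_nth 0) big_mkord.
rewrite (big_ord_widen m.+1 (fun r => nth 0 t r)) // big_mkcond.
by apply: eq_bigr => r _; rewrite x_t; case: ltnP => // le_r; rewrite nth_default.
Qed.

(** By [chains_height] the shape under the outermost strip lacks the last row of [x], so the strip
    contains that row. The weights leave room for no other box, and the whole chain is forced. *)
Lemma chains_diag s x : sorted geq (rev s) -> size s <= m.+1 ->
  (forall r, part x r = nth 0 (rev s) r) -> chains s x = 1.
Proof.
elim: s x => [|k s IHs] x; first by move=> _ _ x0; rewrite /= (weight_nth x0).
rewrite rev_cons => s_sorted le_s x_s.
have nth_x r : part x r
    = if r < size s then nth 0 (rev s) r else if r == size s then k else 0.
  by rewrite x_s nth_rcons size_rev.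
have nth_le r : nth 0 (rev s) r <= part x r.
  by rewrite nth_x; case: ltnP => // le_r; rewrite nth_default ?size_rev.
pose y := mk_shape m (nth 0 (rev s)).
have y_s r : part y r = nth 0 (rev s) r.
  rewrite part_mk // => {}r => [|lt_r].
    exact: leq_trans (nth_le r) (part_le x r).
  by rewrite nth_default // size_rev; apply: leq_trans lt_r; apply: ltnW.
have w_x : weight x = weight y + k.
  rewrite (weight_nth x_s) ?size_rcons ?size_rev // (weight_nth y_s) ?size_rev ?(ltnW le_s) //.
  by rewrite -cats1 sumn_cat /= addn0.
have y_x : strip y x.
  apply/stripP=> r; rewrite y_s; split=> //.
  have [lt_r|le_r] := ltnP r (size s); last first.
    by rewrite nth_x ltnNge (leq_trans le_r) //= gtn_eqF // ltnS.
  have := sortedP 0 s_sorted r; rewrite size_rcons size_rev ltnS => /(_ lt_r).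
  by rewrite /= -x_s nth_rcons size_rev lt_r.
rewrite /= (bigD1 y) /=; last by rewrite y_x w_x eqxx.
rewrite IHs //; last first.
- exact: ltnW.
- by move: s_sorted; rewrite -cats1 => /cat_sorted2[].
rewrite big1 // => z /andP[/andP[z_x /eqP w_z] ne_z]; apply/eqP.
apply: contraTT ne_z => nz; rewrite negbK; apply/eqP.
have le_zy r : part z r <= part y r.
  have [lt_r|le_r] := ltnP r (size s); last by rewrite (chains_height nz).
  by case: (stripP _ _ z_x r) => le_z _; move: le_z; rewrite nth_x lt_r y_s.
have /eqP : weight z = weight y by lia.
rewrite (leqif_sum (fun (r : 'I_m.+1) _ => leqif_eq (le_zy r))).
move=> /forallP eq_zy; apply: eq_shape => r.
have [lt_r|lt_r] := ltnP r m.+1; last by rewrite !part_out.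
exact/eqP/(eq_zy (Ordinal lt_r)).
Qed.

End ChainsTriangular.

Section KostkaPartitions.
Variable m : nat.
Implicit Types p q la ka : intpartn m.

Lemma intpartn_shape p : is_shape m p.
Proof.
case: (intpartnP p) => /and3P[p_sorted _ _]; split=> r.
- have [lt_r|le_r] := ltnP r.+1 (size p); first exact: (sortedP 0 p_sorted).
  by rewrite nth_default.
- have [lt_r|le_r] := ltnP r (size p); first exact/intpartn_leq/mem_nth.
  by rewrite nth_default.
- by move=> lt_r; rewrite nth_default // (leq_trans (intpartn_size p)) // ltnW.
Qed.

Definition rowlens_of p : rowlens m := mk_shape m (nth 0 p).

Lemma Kostka_chains p (la : seq nat) : Kostka p la = chains (rev la) (rowlens_of p).
Proof.
rewrite Kostka_ssyts (card_ssyts _ _ (intpartn_shape p)).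
by congr (chains (rev _) _); apply: mkseq_nth.
Qed.

Lemma sumn_take t i : sumn (take i t) = \sum_(r < i) nth 0 t r.
Proof.
elim: t i => [|a t IHt] [|i]; rewrite ?big_ord0 //=.
  by rewrite big1 // => r _; rewrite nth_nil.
by rewrite big_ord_recl /= IHt.
Qed.

Lemma Kostka_dominated p la : Kostka p la != 0 -> dominated la p.
Proof.
rewrite Kostka_chains => nz; apply/dominatedP=> i.
(* The first [i] parts of [la] belong to the innermost strips, hence to the tail of the reversed
   content. *)
have := @chains_dominated m (rev (drop i la)) (rev (take i la)) (rowlens_of p).
rewrite -rev_cat cat_take_drop => /(_ nz); rewrite sumn_rev size_rev size_take_min => le_s.
apply: leq_trans le_s _; rewrite sumn_take.
rewrite (eq_bigr (fun r : 'I__ => nth 0 p r)); last first.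
  by move=> r _; rewrite part_mk_nth //; apply: intpartn_shape.
rewrite -(big_mkord xpredT (nth 0 p)) -(big_mkord xpredT (nth 0 p)).
by rewrite [X in _ <= X](big_cat_nat (n := minn i (size la))) ?geq_minl //= leq_addr.
Qed.

Lemma Kostka_diag p : Kostka p p = 1.
Proof.
rewrite Kostka_chains; apply: chains_diag; rewrite ?revK ?size_rev.
- by case: (intpartnP p) => /and3P[].
- exact: leq_trans (intpartn_size p) _.
- by move=> r; rewrite part_mk_nth //; apply: intpartn_shape.
Qed.

Lemma eq_from_nth_partn (s t : seq nat) : 0 \notin s -> 0 \notin t ->
  (forall r, nth 0 s r = nth 0 t r) -> s = t.
Proof.
have le_size (u v : seq nat) : 0 \notin u -> (forall r, nth 0 u r = nth 0 v r) ->
    size u <= size v.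
  move=> u_n0 eq_uv; rewrite leqNgt; apply: contra u_n0 => lt_vu.
  by rewrite -[0](nth_default 0 (leqnn (size v))) -eq_uv mem_nth.
move=> s_n0 t_n0 eq_st; apply: (@eq_from_nth _ 0) => [|i _]; last exact: eq_st.
by apply/eqP; rewrite eqn_leq !le_size // => r; rewrite eq_st.
Qed.

(** The RSK count runs over all shapes in the box. A shape that carries a chain of content [la] has
    weight [m] and decreasing rows, so it comes from a partition of [m]; all others contribute
    zero. *)
Lemma sum_Kostka2 la ka :
  \sum_(p : intpartn m) Kostka p la * Kostka p ka = size (margin_mxs (rev la) (rev ka)).
Proof.
have sum_la : sumn la = m by case: (intpartnP la) => /and3P[_ _ /eqP].
rewrite -(sum_chains2 (m := m)) ?sumn_rev ?sum_la //.
rewrite (eq_bigr (fun p => chains (rev la) (rowlens_of p) * chains (rev ka) (rowlens_of p)));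
  last by move=> p _; rewrite !Kostka_chains.
have rl_inj : injective rowlens_of.
  move=> p q eq_pq; apply/val_inj/eq_from_nth_partn.
  - by case/and3P: (intpartnP p).
  - by case/and3P: (intpartnP q).
  - by move=> r; rewrite -!(@part_mk_nth m) ?[mk_shape _ _]eq_pq //; apply: intpartn_shape.
rewrite [RHS](bigID (mem [set rowlens_of p | p : intpartn m])) /=.
rewrite [X in _ = _ + X]big1 ?addn0 => [|x].
  by rewrite big_imset //=; apply: in2W.
apply: contraNeq; rewrite muln_eq0 negb_or => /andP[nz _].
have w_x : weight x = m by rewrite (chains_weight nz) sumn_rev.
have x_dec := chains_dec nz.
(* The number of nonempty rows, where the row lengths must be cut to leave no zero part. *)
pose n := \sum_(r < m.+1) (part x r != 0).
have lt_n r : (r < n) = (part x r != 0).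
  apply: (count_down_closed (p := fun r => part x r != 0)) => {}r; rewrite -!lt0n; first by have := x_dec r; lia.
  by apply: contraLR; rewrite -leqNgt => lt_r; rewrite part_out.
have nth_p r : part x r = nth 0 (mkseq (part x) n) r.
  have [lt_r|le_r] := ltnP r n; first by rewrite nth_mkseq.
  rewrite nth_default ?size_mkseq //; apply/eqP; apply: contraLR le_r.
  by rewrite -ltnNge lt_n.
have p_ok : is_intpartn m (mkseq (part x) n).
  apply/and3P; split.
  - by apply/(sortedP 0)=> r _; rewrite -!nth_p /geq /= x_dec.
  - apply/mapP=> -[r]; rewrite mem_iota add0n => /andP[_].
    by rewrite lt_n => /eqP nz_r /esym.
  - rewrite -(weight_nth nth_p) ?w_x // size_mkseq.
    by apply: leq_trans (leq_sum _ (fun i _ => leq_b1 _)) _; rewrite sum1_card card_ord.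
apply/imsetP; exists (IntPartn p_ok) => //.
by apply: eq_shape => r; rewrite nth_p part_mk_nth //; apply: (intpartn_shape (IntPartn p_ok)).
Qed.

End KostkaPartitions.

(** * The group algebra *)

Local Open Scope ring_scope.

Section GroupAlgebra.
Variables (gT : finGroupType) (G : {group gT}).
Local Notation aG := (regular_repr algC G).
Local Notation R_G := (group_ring algC G).
Local Notation nG := (gcard G).
Implicit Types (A B E X : 'M[algC]_nG).

(** For [A] in the group ring this is the coefficient of [x] in [A], read off the row of the
    identity; it makes sense for any matrix. *)
Definition gcoef A x : algC := gring_row A 0 (gring_index G x).

Lemma gcoefZ c A x : gcoef (c *: A) x = c * gcoef A x.
Proof. by rewrite /gcoef linearZ mxE. Qed.

Lemma gcoef_sum I r (P : pred I) (F : I -> 'M[algC]_nG) x :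
  gcoef (\sum_(i <- r | P i) F i) x = \sum_(i <- r | P i) gcoef (F i) x.
Proof. by rewrite /gcoef linear_sum summxE. Qed.

Lemma gcoef_repr : {in G &, forall x y, gcoef (aG x) y = (x == y)%:R}.
Proof.
move=> x y Gx Gy; rewrite /gcoef /gring_row /= !mxE eqxx /= gring_indexK // mul1g.
by rewrite (can_in_eq (gring_indexK (G := G))) // eq_sym.
Qed.

Lemma gcoefMr A : {in G &, forall x y, gcoef (A *m aG y) x = gcoef A (x * y^-1)%g}.
Proof.
move=> x y Gx Gy; rewrite /gcoef gring_row_mul mxE.
rewrite (bigD1 (gring_index G (x * y^-1)%g)) //= big1 => [|i ne_i].
  by rewrite !mxE gring_indexK ?groupM ?groupV // mulgKV !eqxx mulr1 addr0.
rewrite !mxE eqxx (can_in_eq (gring_indexK (G := G))) ?groupM ?enum_valP //.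
case: eqP => [def_x|]; last by rewrite mulr0.
by case/eqP: ne_i; rewrite def_x mulgK gring_valK.
Qed.

Lemma group_ring_sum A : (A \in R_G)%MS -> A = \sum_(x in G) gcoef A x *: aG x.
Proof.
move=> R_A; rewrite -{1}(gring_rowK R_A) /gring_mx /= mulmx_sum_row linear_sum.
rewrite (reindex_onto (@enum_val _ (mem G)) (gring_index G)) /=; last exact: gring_indexK.
apply: eq_big => [i|i _]; first by rewrite enum_valP gring_valK eqxx.
by rewrite linearZ /= rowK mxvecK /gcoef gring_valK.
Qed.

Lemma mulmx_group_ring_sum A B Z : (Z \in R_G)%MS ->
  A *m Z *m B = \sum_(x in G) gcoef Z x *: (A *m aG x *m B).
Proof.
move=> R_Z; rewrite {1}(group_ring_sum R_Z) mulmx_sumr mulmx_suml.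
by apply: eq_bigr => x _; rewrite -scalemxAr -scalemxAl.
Qed.

Lemma gcoefM A B z : (B \in R_G)%MS -> z \in G ->
  gcoef (A *m B) z = \sum_(x in G) gcoef B x * gcoef A (z * x^-1)%g.
Proof.
move=> R_B Gz; rewrite {1}(group_ring_sum R_B) mulmx_sumr gcoef_sum.
by apply: eq_bigr => x Gx; rewrite -scalemxAr gcoefZ gcoefMr.
Qed.

(* When A is c times an idempotent, this says that chi is the character of
   the right ideal that A generates; see [cfRepr_right_ideal]. *)
Definition affords (c : algC) A (chi : 'CF(G)) :=
  {in G, forall g, c * chi g = \sum_(h in G) gcoef A (h * g^-1 * h^-1)%g}.

(** [P] factors through [U] and acts there as [c]; rotating the trace of [P *m rG g] through this
    factorization leaves the trace on [U]. *)
Lemma mxtrace_submod n (rG : mx_representation algC G n) (U P : 'M_n)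
    (modU : mxmodule rG U) c g :
  g \in G -> (P <= U)%MS -> P *m rG g = rG g *m P ->
  (forall v : 'rV_n, (v <= U)%MS -> v *m P = c *: v) ->
  \tr (P *m rG g) = c * \tr (submod_repr modU g).
Proof.
move=> Gg sPU cPg idP; set io := @val_submod _ _ U _ 1%:M.
have ioP : io *m P = c *: io.
  apply/row_matrixP=> i; rewrite row_mul linearZ; apply: idP.
  by apply: submx_trans (row_sub i _) _; rewrite val_submod1.
rewrite -(in_submodK sPU) val_submodE in_submodE -mulmxA mxtrace_mulC -/io.
rewrite -mulmxA [rG g *m _]mulmxA -cPg -[P *m _ *m _]mulmxA (mulmxA io P) ioP -scalemxAl linearZ /=.
by rewrite mulmxA -in_submodE.
Qed.

(** [P] is left multiplication by [E] on the regular representation. Its image lies in the right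
    ideal of [E], on which it acts as [c] since [E *m E = c *: E]; the trace of [P] followed by [g],
    taken in the basis of group elements, is the sum in [affords]. *)
Lemma cfRepr_right_ideal c E : (E \in R_G)%MS -> E *m E = c *: E ->
  affords c E
    (cfRepr (submod_repr (cyclic_mx_module aG (gring_row E)))).
Proof.
move=> R_E EE g Gg; set e := gring_row E; rewrite cfunE Gg mulr1n.
pose P := lin1_mx (mulmx e \o gring_mx aG).
have vP (v : 'rV_nG) : v *m P = e *m gring_mx aG v by rewrite mul_rV_lin1.
rewrite -(@mxtrace_submod _ _ _ P) //; last 3 first.
- apply/row_subP=> i; rewrite rowE vP; apply/cyclic_mxP.
  by exists (gring_mx aG (delta_mx 0 i)); rewrite ?gring_mxP.
- by apply/row_matrixP=> i; rewrite !rowE !mulmxA !vP gring_mxJ // mulmxA.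
- move=> v /cyclic_mxP[A R_A ->]; rewrite vP -[e *m A]gring_row_mul gring_rowK ?envelop_mxM //.
  by rewrite -[LHS]gring_row_mul mulmxA EE -scalemxAl linearZ.
rewrite /mxtrace (reindex_onto (gring_index G) enum_val) /=; last by move=> i; rewrite gring_valK.
rewrite (eq_bigl (mem G)) => [|x]; last first.
  apply/eqP/idP=> [<-|/gring_indexK//]; exact: enum_valP.
apply: eq_bigr => h Gh; rewrite -!gcoefMr ?groupM ?groupV //.
have -> : (P *m aG g) (gring_index G h) (gring_index G h)
    = row (gring_index G h) (P *m aG g) 0 (gring_index G h) by rewrite [RHS]mxE.
have gring_row_repr : delta_mx 0 (gring_index G h) = gring_row (aG h).
  by rewrite /gring_row rowK gring_indexK // mul1g.
rewrite rowE mulmxA vP gring_row_repr gring_rowK ?envelop_mx_id //.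
by rewrite /gcoef !gring_row_mul.
Qed.

(** The right side is the trace of [h |-> A h E]. Since [s] is a character, conjugating its value at
    [g] amounts to inverting [g]; as [chi] is a class function, the conjugates in [affords] then
    collapse to the sum of [gcoef E x * chi x], into which [affords] for [A] is inserted. *)
Lemma cfdot_affords c E (s : 'CF(G)) d A (chi : 'CF(G)) :
    (E \in R_G)%MS -> s \is a character -> affords c E s -> affords d A chi ->
  c * d * '[chi, s] = \sum_(h in G) gcoef (A *m aG h *m E) h.
Proof.
move=> R_E char_s sE chiA.
have nz_G : #|G|%:R != 0 :> algC by rewrite pnatr_eq0 -lt0n cardG_gt0.
have step1 : c * '[chi, s] = \sum_(x in G) gcoef E x * chi x.
  rewrite cfdotE mulrCA mulr_sumr.
  rewrite (eq_bigr (fun g => \sum_(h in G) gcoef E (h * g * h^-1)%g * chi g)); last first.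
    move=> g Gg; rewrite -char_inv // mulrCA sE ?groupV // invgK mulrC mulr_suml.
    by [].
  rewrite exchange_big /= (eq_bigr (fun _ => \sum_(x in G) gcoef E x * chi x)).
    by rewrite sumr_const -[X in _ * X]mulr_natl mulKf.
  move=> h Gh; rewrite (reindex_inj (conjg_inj h)) /=.
  apply: eq_big => [g|g Gg]; first by rewrite memJ_norm ?(subsetP (normG G)).
  by rewrite cfunJ // conjgE !mulgA mulgV mul1g mulgK.
rewrite mulrAC step1 mulr_suml.
rewrite (eq_bigr (fun x => \sum_(h in G) gcoef E x * gcoef A (h * x^-1 * h^-1)%g)).
  rewrite exchange_big; apply: eq_bigr => h Gh; rewrite gcoefM //.
  by apply: eq_bigr => x Gx; rewrite gcoefMr ?groupM ?groupV.
by move=> x Gx; rewrite -mulrA (mulrC _ d) chiA // mulr_sumr.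
Qed.

(** If [X h E] is [k_h] times [E], its coefficient at [h] is [k_h] times that of [E], and summing
    over [h] puts a second factor [E] into the product. *)
Lemma sum_gcoef_scalar X E : (E \in R_G)%MS ->
  {in G, forall h, X *m aG h *m E = gcoef (X *m aG h *m E) 1 *: E} ->
  \sum_(h in G) gcoef (X *m aG h *m E) h = gcoef (X *m E *m E) 1.
Proof.
move=> R_E XE; rewrite (mulmx_group_ring_sum _ _ R_E) gcoef_sum; apply: eq_bigr => h Gh.
by rewrite gcoefZ {1}XE // gcoefZ mulrC.
Qed.

Lemma affords_Ind1 (H : {group gT}) : H \subset G ->
  affords #|H|%:R (\sum_(x in H) aG x) ('Ind[G, H] 1).
Proof.
move=> sHG g Gg; rewrite cfIndE // mulVKf; last by rewrite pnatr_eq0 -lt0n cardG_gt0.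
rewrite (reindex_inj invg_inj) /=; apply: eq_big => [h|h]; rewrite groupV // => Gh.
rewrite cfun1E conjgE invgK gcoef_sum -groupV !invMg !invgK -mulgA.
have [Hx|nHx] := boolP (_ \in H).
  rewrite (bigD1 _ Hx) /= big1 ?addr0 => [|x /andP[Hx' ne_x]].
    by rewrite gcoef_repr ?eqxx ?groupM ?groupV.
  by rewrite gcoef_repr ?(negPf ne_x) ?groupM ?groupV // (subsetP sHG).
rewrite big1 // => x Hx; have Gx := subsetP sHG x Hx.
by rewrite gcoef_repr ?groupM ?groupV //; case: eqP Hx nHx => // -> ->.
Qed.

Lemma trmx_regular : {in G, forall x, (aG x)^T = aG x^-1%g}.
Proof.
move=> x Gx; apply/matrixP=> i j; rewrite !mxE /=; congr (_%:R); congr nat_of_bool.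
apply/eqP/eqP=> [->|->]; rewrite gring_indexK ?groupM ?groupV ?enum_valP //.
  by rewrite mulgK gring_valK.
by rewrite mulgKV gring_valK.
Qed.

Lemma real_mul_tr_eq0 (M : 'M[algC]_nG) :
  M \is a mxOver Num.real -> M *m M^T = 0 -> M = 0.
Proof.
move=> /mxOverP M_real MM; apply/matrixP=> i j; rewrite [RHS]mxE.
have /eqP := congr1 (fun N : 'M_nG => N i i) MM; rewrite !mxE.
have sq k : M i k * M^T k i = M i k ^+ 2 by rewrite mxE expr2.
rewrite (eq_bigr _ (fun k _ => sq k)) psumr_eq0 => [|k _]; last exact: real_exprn_even_ge0.
by move=> /allP/(_ j); rewrite mem_index_enum sqrf_eq0 => /(_ isT)/eqP.
Qed.

End GroupAlgebra.

(** * Rows and columns of the row-reading tableau *)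

Local Open Scope nat_scope.

Section RowReading.
Variable m : nat.
Implicit Types p q : intpartn m.

Definition rrow p (i : 'I_m) := reshape_index p i.
Definition rcol p (i : 'I_m) := reshape_offset p i.

Lemma intpartn_sumn p : sumn p = m.
Proof. by case/and3P: (intpartnP p) => _ _ /eqP. Qed.

Lemma rcol_lt p i : rcol p i < nth 0 p (rrow p i).
Proof. by apply: reshape_offsetP; rewrite intpartn_sumn. Qed.

Lemma rcol_ltm p i : rcol p i < m.
Proof. by apply: leq_trans (rcol_lt p i) _; case: (intpartn_shape p). Qed.

Lemma box_pos p r c : c < nth 0 p r -> exists2 i, rrow p i = r & rcol p i = c.
Proof.
move=> lt_c; have := flatten_indexP lt_c; rewrite intpartn_sumn => lt_m.
by exists (Ordinal lt_m); [apply: flatten_indexKl | apply: flatten_indexKr].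
Qed.

Lemma box_inj p i j : rrow p i = rrow p j -> rcol p i = rcol p j -> i = j.
Proof.
rewrite /rrow /rcol => eq_r eq_c; apply/val_inj.
by rewrite /= -(reshape_indexK p i) eq_r eq_c reshape_indexK.
Qed.

Lemma intpartn_nonincr p r s : r <= s -> nth 0 p s <= nth 0 p r.
Proof.
move/subnKC <-; have [p_dec _ _] := intpartn_shape p.
elim: (s - r) => [|d IHd]; first by rewrite addn0.
by rewrite addnS (leq_trans (p_dec _)).
Qed.

Lemma sumn_take_mono (t : seq nat) k l : k <= l -> sumn (take k t) <= sumn (take l t).
Proof.
move=> le_kl; rewrite !sumn_take -(big_mkord xpredT (nth 0 t)).
by rewrite -(big_mkord xpredT (nth 0 t)) [X in _ <= X](big_cat_nat (n := k)) ?leq_addr.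
Qed.

Lemma card_rrow_lt p k : #|[set i | rrow p i < k]| = sumn (take k p).
Proof.
have le_m : sumn (take k p) <= m.
  by rewrite -{2}(intpartn_sumn p) -{2}(cat_take_drop k p) sumn_cat leq_addr.
rewrite -[RHS](sum_ltn le_m) -sum1dep_card big_mkcond; apply: eq_bigr => i _.
suff -> : (rrow p i < k) = (i < sumn (take k p)) by case: ifP.
have def_i := reshape_indexK p i; rewrite /flatten_index -/(rrow p i) -/(rcol p i) in def_i.
apply/idP/idP=> [lt_k|]; last first.
  by apply: contraLR; rewrite -!leqNgt => /(sumn_take_mono p); lia.
apply: leq_trans (sumn_take_mono p lt_k); rewrite sumn_take big_ord_recr /= -sumn_take.
by have := rcol_lt p i; lia.
Qed.

Section Separated.
Variables (p q : intpartn m) (g : 'S_m).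
Hypothesis sep : forall i j, rrow p i = rrow p j -> rcol q (g i) = rcol q (g j) -> i = j.

Let X k c := [set i | (rrow p i < k) && (rcol q (g i) == c)].
Let Y k c := [set j | (rrow q j < k) && (rcol q j == c)].

(** Each row of [p] sends at most one entry to column [c] of [q], so [#|X k c|] is at most [k] and
    at most the height of that column. The smaller of the two is [#|Y k c|]; summing over [c] gives
    dominance. *)
Let card_X_le k c : #|X k c| <= #|Y k c|.
Proof.
have [/existsP[j /andP[/eqP j_c le_k]]|] := boolP [exists j, (rcol q j == c) && (k <= rrow q j)].
  apply: (@leq_trans k).
    case: k le_k => [|k] le_k; first by rewrite leqn0 cards_eq0 -subset0; apply/subsetP=> i; rewrite inE.
    rewrite -[X in _ <= X]card_ord.
    have inj_r : {in X k.+1 c &, injective (fun i => inord (rrow p i) : 'I_k.+1)}.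
      move=> i i' /[!inE] /andP[lt_i /eqP i_c] /andP[lt_i' /eqP i'_c].
      by move/(congr1 val); rewrite /= !inordK // => eq_r; apply: sep; rewrite ?i_c ?i'_c.
    by rewrite -(card_in_imset inj_r) max_card.
  have pos (r : 'I_k) : exists i, (rrow q i == r :> nat) && (rcol q i == c).
    have [|i i_r i_c] := @box_pos q r c; last by exists i; rewrite i_r i_c !eqxx.
    rewrite -j_c; apply: leq_trans (rcol_lt q j) (intpartn_nonincr _ _).
    by apply: leq_trans le_k; apply: ltnW.
  pose f r := xchoose (pos r).
  have fP r : rrow q (f r) = r /\ rcol q (f r) = c.
    by have /andP[/eqP ? /eqP ?] := xchooseP (pos r).
  have inj_f : injective f.
    by move=> r s eq_f; apply/val_inj; rewrite /= -(fP r).1 -(fP s).1 eq_f.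
  rewrite -[X in X <= _]card_ord -(card_imset _ inj_f).
  apply/subset_leq_card/subsetP=> _ /imsetP[r _ ->]; rewrite inE.
  by have [-> ->] := fP r; rewrite ltn_ord eqxx.
move/existsPn=> low; rewrite -(card_imset _ (@perm_inj _ g)).
apply/subset_leq_card/subsetP=> _ /imsetP[i /[!inE]/andP[_ i_c] ->].
by have := low (g i); rewrite i_c /= -ltnNge => ->.
Qed.

Let sum_X k : \sum_(c < m) #|X k c| = sumn (take k p).
Proof.
rewrite -card_rrow_lt -[RHS]sum1dep_card.
rewrite [RHS](partition_big (fun i => Ordinal (rcol_ltm q (g i))) predT) //=.
by apply: eq_bigr => c _; rewrite -sum1dep_card.
Qed.

Let sum_Y k : \sum_(c < m) #|Y k c| = sumn (take k q).
Proof.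
rewrite -card_rrow_lt -[RHS]sum1dep_card.
rewrite [RHS](partition_big (fun i => Ordinal (rcol_ltm q i)) predT) //=.
by apply: eq_bigr => c _; rewrite -sum1dep_card.
Qed.

Lemma separated_dominated : dominated p q.
Proof.
by apply/dominatedP=> k; rewrite -sum_X -sum_Y; apply: leq_sum => c _.
Qed.

(** For [p = q] the sums over columns agree, so every inequality of [card_X_le] is an equality. An
    entry of row [r] sent to column [c] makes [X] grow at [r], hence [Y] too, and row [r] has a box
    in column [c]. *)
Lemma separated_col_lt : p = q -> forall i, rcol q (g i) < nth 0 p (rrow p i).
Proof.
move=> eq_pq i; have eq_XY k c : c < m -> #|X k c| = #|Y k c|.
  move=> lt_c; have : \sum_(c < m) #|X k c| == \sum_(c < m) #|Y k c|.
    by rewrite sum_X sum_Y eq_pq.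
  rewrite (leqif_sum (fun (c : 'I_m) _ => leqif_eq (card_X_le k c))).
  by move=> /forallP/(_ (Ordinal lt_c))/eqP.
set c := rcol q (g i); set r := rrow p i; rewrite ltnNge; apply/negP=> le_c.
have lt_c : c < m by apply: rcol_ltm.
have XS : X r c \proper X r.+1 c.
  rewrite properE; apply/andP; split.
    by apply/subsetP=> j; rewrite !inE => /andP[/ltnW lt_j ->]; rewrite ltnS lt_j.
  by apply/subsetPn; exists i; rewrite !inE ?ltnn // ltnSn eqxx.
have := proper_card XS; rewrite !eq_XY // ltnNge => /negP; apply.
apply/subset_leq_card/subsetP=> j; rewrite !inE ltnS leq_eqVlt => /andP[/orP[/eqP j_r|->//] /eqP j_c].
by have := rcol_lt q j; rewrite j_r j_c -eq_pq ltnNge le_c.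
Qed.

End Separated.

(** [u] moves each entry along its own row to the column in which [g] puts it; the rest of [g] then
    preserves columns. *)
Lemma separated_factor p (g : 'S_m) :
  (forall i j, rrow p i = rrow p j -> rcol p (g i) = rcol p (g j) -> i = j) ->
  exists2 u, u \in row_stab m p & exists2 v, v \in col_stab m p & g = (u * v)%g.
Proof.
move=> sep; have lt_col := separated_col_lt sep erefl.
have pos i : exists j, (rrow p j == rrow p i) && (rcol p j == rcol p (g i)).
  by have [j j_r j_c] := box_pos (lt_col i); exists j; rewrite j_r j_c !eqxx.
pose f i := xchoose (pos i).
have fP i : rrow p (f i) = rrow p i /\ rcol p (f i) = rcol p (g i).
  by have /andP[/eqP ? /eqP ?] := xchooseP (pos i).
have inj_f : injective f.
  move=> i j eq_f; have [ri ci] := fP i; have [rj cj] := fP j.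
  by apply: sep; rewrite -?ri -?rj -?ci -?cj eq_f.
exists (perm inj_f).
  by rewrite inE; apply/forallP=> i; rewrite permE; case: (fP i) => /eqP.
exists ((perm inj_f)^-1 * g)%g; last by rewrite mulKVg.
rewrite inE; apply/forallP=> i; rewrite permM -{2}(permKV (perm inj_f) i).
set j := ((perm inj_f)^-1)%g i; rewrite permE; case: (fP j) => _.
by rewrite /rcol => ->.
Qed.

End RowReading.

(** * Specht characters *)

Local Open Scope ring_scope.

Section FiberStabilizer.
Variables (m : nat) (T : eqType).
Implicit Type f : 'I_m -> T.

(** Row stabilizers, column stabilizers, Young subgroups and stabilizers of words all have this
    form. *)
Definition fiber_stab f : {set 'S_m} := [set u : 'S_m | [forall i, f (u i) == f i]].

Lemma fiber_stabP f (u : 'S_m) : reflect (forall i, f (u i) = f i) (u \in fiber_stab f).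
Proof. by rewrite inE; apply: (iffP forallP) => uf i; apply/eqP/uf. Qed.

Lemma fiber_stab_group_set f : group_set (fiber_stab f).
Proof.
apply/group_setP; split=> [|u v /fiber_stabP uf /fiber_stabP vf].
  by apply/fiber_stabP=> i; rewrite perm1.
by apply/fiber_stabP=> i; rewrite permM vf uf.
Qed.
Canonical fiber_stab_group f := Group (fiber_stab_group_set f).

Lemma tperm_fiber_stab f i j : f i = f j -> tperm i j \in fiber_stab f.
Proof. by move=> eq_f; apply/fiber_stabP=> k; case: tpermP => // ->. Qed.

End FiberStabilizer.

Section Specht.
Variable m : nat.
Implicit Types p q : intpartn m.
Local Notation G := [set: 'S_m].
Local Notation aG := (regular_repr algC G).
Local Notation R_G := (group_ring algC G).
Local Notation rstab p := (fiber_stab (rrow p)).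
Local Notation cstab p := (fiber_stab (rcol p)).

Definition row_sum p := \sum_(u in rstab p) aG u.
Definition col_sum p := \sum_(v in cstab p) (-1) ^+ (v : bool) *: aG v.
Definition ysym p := row_sum p *m col_sum p.

Lemma aGM (u v : 'S_m) : aG u *m aG v = aG (u * v)%g.
Proof. by rewrite repr_mxM ?inE. Qed.

Lemma row_sum_mulr p u : u \in rstab p -> row_sum p *m aG u = row_sum p.
Proof.
move=> Ru; rewrite mulmx_suml (reindex_inj (mulIg u^-1%g)) /=.
apply: eq_big => [v|v _]; first by rewrite groupMr // groupV.
by rewrite aGM mulgKV.
Qed.

Lemma col_sum_mull p v : v \in cstab p ->
  aG v *m col_sum p = (-1) ^+ (v : bool) *: col_sum p.
Proof.
move=> Cv; rewrite mulmx_sumr scaler_sumr (reindex_inj (mulgI v^-1%g)) /=.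
apply: eq_big => [u|u _]; first by rewrite groupMl // groupV.
by rewrite -scalemxAr aGM mulKVg odd_permM odd_permV signr_addb scalerA.
Qed.

Lemma row_sum_sq p : row_sum p *m row_sum p = #|rstab p|%:R *: row_sum p.
Proof.
rewrite {2}/row_sum mulmx_sumr (eq_bigr _ (@row_sum_mulr p)).
by rewrite sumr_const scaler_nat.
Qed.

Lemma col_sum_sq p : col_sum p *m col_sum p = #|cstab p|%:R *: col_sum p.
Proof.
rewrite {1}/col_sum mulmx_suml (eq_bigr (fun=> col_sum p)) => [|v Cv].
  by rewrite sumr_const scaler_nat.
by rewrite -scalemxAl col_sum_mull // scalerA -signr_addb addbb scale1r.
Qed.

Lemma row_sum_ring p : (row_sum p \in R_G)%MS.
Proof. by rewrite linear_sum summx_sub // => u _; rewrite envelop_mx_id ?inE. Qed.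

Lemma col_sum_ring p : (col_sum p \in R_G)%MS.
Proof.
rewrite linear_sum summx_sub // => u _.
by rewrite linearZ scalemx_sub // envelop_mx_id ?inE.
Qed.

Lemma ysym_ring p : (ysym p \in R_G)%MS.
Proof. by rewrite envelop_mxM ?row_sum_ring ?col_sum_ring. Qed.

Lemma young_symmetrizerE p : young_symmetrizer m p = gring_row (ysym p).
Proof.
rewrite /ysym /row_sum mulmx_suml linear_sum; apply: eq_bigr => u _.
rewrite /col_sum mulmx_sumr linear_sum; apply: eq_bigr => v _.
rewrite -scalemxAr linearZ /= -/(regular_repr algC G) aGM; congr (_ *: _).
by rewrite /gring_row rowK gring_indexK ?inE // mul1g.
Qed.

(* If g moves two entries of a row of p into one column of q, the transposition
   exchanging them is absorbed by row_sum p, and by col_sum q up to a sign. *)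
Lemma sandwich_unseparated p q (g : 'S_m) i j :
  i != j -> rrow p i = rrow p j -> rcol q (g i) = rcol q (g j) ->
  row_sum p *m aG g *m col_sum q = 0.
Proof.
move=> ne_ij eq_r eq_c; set Z := LHS.
suff /eqP : Z = - Z by rewrite -addr_eq0 -mulr2n -scaler_nat scaler_eq0 pnatr_eq0 => /eqP.
rewrite {1}/Z -(row_sum_mulr (tperm_fiber_stab eq_r)) -(mulmxA (row_sum p)) aGM conjgC tpermJ.
rewrite -aGM mulmxA -mulmxA col_sum_mull; last exact: tperm_fiber_stab.
by rewrite odd_tperm (inj_eq perm_inj) ne_ij expr1 scaleN1r mulmxN.
Qed.

Lemma sandwich_separated p q (g : 'S_m) :
  row_sum p *m aG g *m col_sum q != 0 ->
  forall i j, rrow p i = rrow p j -> rcol q (g i) = rcol q (g j) -> i = j.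
Proof.
move=> nz i j eq_r eq_c; apply: contraNeq nz => ne_ij.
exact/eqP/(sandwich_unseparated ne_ij eq_r eq_c).
Qed.

Lemma sandwich_dominated p q (g : 'S_m) :
  row_sum p *m aG g *m col_sum q != 0 -> dominated p q.
Proof. by move/sandwich_separated/separated_dominated. Qed.

(** A permutation that preserves both rows and columns is trivial, so the identity arises only as
    [1 * 1]. *)
Lemma gcoef_ysym1 p : gcoef (ysym p) 1 = 1.
Proof.
rewrite /ysym /row_sum mulmx_suml gcoef_sum (bigD1 1%g) ?group1 //=.
rewrite repr_mx1 mul1mx /col_sum gcoef_sum (bigD1 1%g) ?group1 //=.
rewrite gcoefZ odd_perm1 mul1r gcoef_repr ?inE // eqxx.
rewrite [X in _ + X + _]big1 ?addr0 => [|v /andP[_ ne_v]]; last first.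
  by rewrite gcoefZ gcoef_repr ?inE // (negPf ne_v) mulr0.
rewrite big1 ?addr0 // => u /andP[Ru ne_u].
rewrite mulmx_sumr gcoef_sum big1 // => v Cv.
rewrite -scalemxAr gcoefZ aGM gcoef_repr ?inE //; case: eqP; rewrite ?mulr0 // => uv1.
case/eqP: ne_u; apply/permP=> i; rewrite perm1; apply: (@box_inj _ p).
  exact: (fiber_stabP _ _ Ru).
have /fiber_stabP Cu : u \in cstab p by rewrite -groupV (mulg1_eq uv1).
exact: Cu.
Qed.

Lemma sandwich_repr p (g : 'S_m) :
  exists c, row_sum p *m aG g *m col_sum p = c *: ysym p.
Proof.
have [->|/sandwich_separated/separated_factor[u Ru [v Cv ->]]] :=
    eqVneq (row_sum p *m aG g *m col_sum p) 0; first by exists 0; rewrite scale0r.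
exists ((-1) ^+ (v : bool)); rewrite -aGM mulmxA row_sum_mulr //.
by rewrite -mulmxA col_sum_mull // -scalemxAr.
Qed.

(** Von Neumann's lemma: a separated [g] factors as row part times column part, both absorbed up to
    sign, and any other [g] contributes zero. By [gcoef_ysym1] the scalar is the coefficient of the
    identity. *)
Lemma sandwich p Z : (Z \in R_G)%MS ->
  row_sum p *m Z *m col_sum p = gcoef (row_sum p *m Z *m col_sum p) 1 *: ysym p.
Proof.
move=> R_Z; suff [c ->] : exists c, row_sum p *m Z *m col_sum p = c *: ysym p.
  by rewrite gcoefZ gcoef_ysym1 mulr1.
have [c cP] : exists c : 'S_m -> algC, forall g,
   row_sum p *m aG g *m col_sum p = c g *: ysym p.
  apply: (fin_all_exists (fun g => sandwich_repr p g)).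
exists (\sum_(g in G) gcoef Z g * c g); rewrite scaler_suml.
rewrite (mulmx_group_ring_sum _ _ R_Z).
by apply: eq_bigr => g _; rewrite cP scalerA.
Qed.

Definition ycoef p := gcoef (ysym p *m ysym p) 1.

Lemma ysym_sq p : ysym p *m ysym p = ycoef p *: ysym p.
Proof.
rewrite /ycoef /ysym !mulmxA -(mulmxA (row_sum p)).
by rewrite {1}sandwich // envelop_mxM ?row_sum_ring ?col_sum_ring.
Qed.

Lemma ysym_neq0 p : ysym p != 0.
Proof.
apply: contra_eq_neq (gcoef_ysym1 p) => ->.
by rewrite -(scale0r 0) gcoefZ mul0r eq_sym oner_eq0.
Qed.

(* row_sum p and col_sum p are real symmetric, so A *m A^T != 0 for every
   nonzero product A of them. *)
Lemma ycoef_neq0 p : ycoef p != 0.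
Proof.
set A := row_sum p; set B := col_sum p.
have realG (u : 'S_m) i j : aG u i j \is Num.real by rewrite !mxE realn.
have realA : A \is a mxOver Num.real.
  by apply/mxOverP=> i j; rewrite /A /row_sum summxE rpred_sum.
have realB : B \is a mxOver Num.real.
  apply/mxOverP=> i j; rewrite /B /col_sum summxE rpred_sum // => v _.
  by rewrite mxE rpredM ?rpredX ?rpredN ?rpred1 ?realG. 
have trA : A^T = A.
  rewrite /A /row_sum linear_sum (reindex_inj invg_inj) /=.
  apply: eq_big => u; rewrite ?groupV // => _.
  by rewrite [LHS]trmx_regular ?inE // invgK.
have trB : B^T = B.
  rewrite /B /col_sum linear_sum (reindex_inj invg_inj) /=.
  apply: eq_big => u; rewrite ?groupV // => _.
  by rewrite linearZ /= odd_permV; congr (_ *: _); rewrite [LHS]trmx_regular ?inE // invgK.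
have nz_A : #|rstab p|%:R != 0 :> algC by rewrite pnatr_eq0 -lt0n cardG_gt0.
have nz_B : #|cstab p|%:R != 0 :> algC by rewrite pnatr_eq0 -lt0n cardG_gt0.
apply: contraNneq (ysym_neq0 p) => n0; have := ysym_sq p.
rewrite n0 scale0r /ysym -/A -/B => ABAB0; apply/eqP.
have ABA0 : A *m B *m A = 0.
  apply: real_mul_tr_eq0; first by rewrite !mxOverM.
  rewrite !trmx_mul trA trB !mulmxA -(mulmxA _ A A) row_sum_sq -scalemxAr.
  by rewrite -!scalemxAl -[A *m B *m A *m B]mulmxA ABAB0 mul0mx scaler0.
apply: real_mul_tr_eq0; first by rewrite mxOverM.
rewrite trmx_mul trA trB !mulmxA -(mulmxA _ B B) col_sum_sq -scalemxAr.
by rewrite -!scalemxAl ABA0 scaler0.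
Qed.

Lemma specht_char_affords p : affords (ycoef p) (ysym p) (specht_char m p).
Proof.
rewrite /specht_char; have := cfRepr_right_ideal (ysym_ring p) (ysym_sq p).
by rewrite -young_symmetrizerE.
Qed.

Lemma specht_char_character p : specht_char m p \is a character.
Proof. exact: cfRepr_char. Qed.

(** Each [ysym p h ysym p] is a multiple of [ysym p], so the trace is the coefficient of the
    identity in the cube of [ysym p], that is [ycoef p ^+ 2]. *)
Lemma cfnorm_specht p : '[specht_char m p] = 1.
Proof.
have := cfdot_affords (ysym_ring p) (specht_char_character p)
  (@specht_char_affords p) (@specht_char_affords p).
rewrite sum_gcoef_scalar ?ysym_ring // => [|h _]; last first.
  rewrite /ysym !mulmxA -2!(mulmxA (row_sum p)) [LHS]sandwich //.
  by rewrite !envelop_mxM ?row_sum_ring ?col_sum_ring ?envelop_mx_id ?inE.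
rewrite ysym_sq -scalemxAl ysym_sq scalerA gcoefZ gcoef_ysym1 mulr1.
by rewrite -[RHS]mulr1 => /mulfI-> //; rewrite mulf_neq0 ?ycoef_neq0.
Qed.

(** [ysym p h ysym q] starts with [row_sum p] and ends with [col_sum q], and without dominance every
    such product vanishes. *)
Lemma cfdot_specht_undominated p q : ~~ dominated p q ->
  '[specht_char m p, specht_char m q] = 0.
Proof.
move=> ndom.
have := cfdot_affords (ysym_ring q) (specht_char_character q)
  (@specht_char_affords q) (@specht_char_affords p).
rewrite big1 => [/eqP|h _].
  by rewrite mulf_eq0 mulf_eq0 (negPf (ycoef_neq0 q)) (negPf (ycoef_neq0 p)) => /eqP.
have zero g : row_sum p *m aG g *m col_sum q = 0.
  by apply: contraNeq ndom; apply: sandwich_dominated.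
suff -> : ysym p *m aG h *m ysym q = 0 by rewrite -(scale0r 0) gcoefZ mul0r.
rewrite /ysym mulmxA -2!(mulmxA (row_sum p)).
have R_Z : (col_sum p *m aG h *m row_sum q \in R_G)%MS.
  by rewrite !envelop_mxM ?row_sum_ring ?col_sum_ring ?envelop_mx_id ?inE.
rewrite mulmxA -(mulmxA (row_sum p)) (mulmx_group_ring_sum _ _ R_Z) big1 // => g _.
by rewrite zero scaler0.
Qed.

Lemma dominated_anti p q : dominated p q -> dominated q p -> p = q.
Proof.
move=> /dominatedP pq /dominatedP qp; have eq_s i : sumn (take i p) = sumn (take i q).
  by apply/eqP; rewrite eqn_leq pq qp.
apply/val_inj/eq_from_nth_partn.
- by case/and3P: (intpartnP p).
- by case/and3P: (intpartnP q).
move=> r; have := eq_s r.+1; rewrite !sumn_take !big_ord_recr /= -!sumn_take eq_s.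
exact: addnI.
Qed.

Lemma cfdot_specht p q : '[specht_char m p, specht_char m q] = (p == q)%:R.
Proof.
have [->|ne_pq] := eqVneq; first exact: cfnorm_specht.
have [dom|ndom] := boolP (dominated p q); last exact: cfdot_specht_undominated.
rewrite cfdotC cfdot_specht_undominated ?rmorph0 //.
by apply: contraNN ne_pq => /(dominated_anti dom)->.
Qed.

(** The induced character is afforded by [row_sum p], whose extra factor in front of [ysym p] only
    multiplies it by the order of the row stabilizer; this order cancels. *)
Lemma cfdot_specht_Ind p :
  '['Ind[G, fiber_stab_group (rrow p)] 1, specht_char m p] = 1.
Proof.
have := cfdot_affords (ysym_ring p) (specht_char_character p)
  (@specht_char_affords p) (affords_Ind1 (subsetT (fiber_stab_group (rrow p)))).
rewrite -/(row_sum p) sum_gcoef_scalar ?ysym_ring // => [|h _]; last first.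
  rewrite /ysym !mulmxA -(mulmxA (row_sum p)) [LHS]sandwich //.
  by rewrite !envelop_mxM ?row_sum_ring ?envelop_mx_id ?inE.
rewrite {1}/ysym (mulmxA (row_sum p)) row_sum_sq -!scalemxAl -/(ysym p) ysym_sq scalerA gcoefZ.
rewrite gcoef_ysym1 mulr1 [X in _ = X]mulrC -[X in _ = X]mulr1 => /mulfI-> //.
by rewrite mulf_neq0 ?ycoef_neq0 // pnatr_eq0 -lt0n cardG_gt0.
Qed.

End Specht.

(** * Words and Young permutation characters *)

Local Open Scope nat_scope.

Section Words.
Variable m : nat.
Local Notation G := [set: 'S_m].

Section Action.
Variable T : finType.
Implicit Types (w : {ffun 'I_m -> T}) (u v : 'S_m).

Definition permute_word w (u : 'S_m) : {ffun 'I_m -> T} := [ffun i => w (u^-1%g i)].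

Lemma permute_word1 w : permute_word w 1 = w.
Proof. by apply/ffunP=> i; rewrite ffunE invg1 perm1. Qed.

Lemma permute_wordM w u v :
  permute_word w (u * v)%g = permute_word (permute_word w u) v.
Proof. by apply/ffunP=> i; rewrite !ffunE invMg permM. Qed.

Canonical word_action := TotalAction permute_word1 permute_wordM.

Definition content w (x : T) := #|[set i | w i == x]|.

Lemma word_fixP w u :
  reflect (forall i, w (u i) = w i) (permute_word w u == w).
Proof.
apply: (iffP eqP) => [/ffunP wu i|wu].
  by have := wu (u i); rewrite ffunE permK.
by apply/ffunP=> i; rewrite ffunE -[in RHS](permKV u i) wu.
Qed.

Lemma astab_word w : 'C_G[w | word_action] = fiber_stab w.
Proof.
apply/setP=> u; rewrite !inE sub1set inE.
by apply/word_fixP/forallP=> wu i; apply/eqP/wu.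
Qed.

Lemma orbit_wordP w w' :
  reflect (content w =1 content w') (w' \in orbit word_action G w).
Proof.
apply: (iffP orbitP) => [[u _ <-] x|eq_c].
  rewrite /content -(card_imset _ (@perm_inj _ u)); apply: eq_card => i.
  rewrite [RHS]inE ffunE; apply/imsetP/idP => [[j /[!inE] wj ->]|w_x].
    by rewrite permK.
  by exists (u^-1%g i); rewrite ?inE ?permKV.
have /tuple_permP[u eq_w] : perm_eq [tuple w i | i < m] [tuple w' i | i < m].
  have count_w (v : {ffun 'I_m -> T}) x : count_mem x [tuple v i | i < m] = content v x.
    rewrite /content cardE size_filter /= count_map enumT; apply: eq_count => i.
    by rewrite /= inE.
  by apply/allP=> x _ /=; rewrite !count_w eq_c.
exists u => //; apply/ffunP=> i; rewrite ffunE.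
have /(congr1 (fun t => tnth t (u^-1%g i))) := val_inj eq_w.
by rewrite !tnth_mktuple permKV.
Qed.

(** Inducing the trivial character from a point stabilizer gives the permutation character on the
    orbit: each point of the orbit of [w] is reached by one coset of the stabilizer. *)
Lemma Ind_fiber_stab w (g : 'S_m) :
  ('Ind[G, fiber_stab_group w] 1 g
     = #|'Fix_(orbit word_action G w | word_action)[g]|%:R)%R.
Proof.
rewrite cfIndE ?subsetT // (reindex_inj invg_inj) /=.
rewrite (eq_bigl (mem G)) => [|u]; last by rewrite !inE.
rewrite (eq_bigr (fun u => (permute_word w u \in 'Fix_word_action[g] : nat)%:R%R)); last first.
  move=> u _; rewrite cfun1E; congr (nat_of_bool _)%:R%R.
  rewrite -[LHS]/(_ \in fiber_stab w) -astab_word in_setI in_setT /=.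
  rewrite conjgE invgK -[permute_word w u]/(word_action w u).
  apply/astab1P/afix1P; rewrite !actM.
    by move/(congr1 (word_action^~ u)); rewrite actKV.
  by move/(congr1 (word_action^~ u^-1%g)); rewrite actK.
rewrite -natr_sum (partition_big (permute_word w) (mem (orbit word_action G w))) /=; last first.
  by move=> u Gu; apply: mem_orbit.
rewrite (eq_bigr (fun x => (x \in 'Fix_word_action[g]) * #|fiber_stab w|)); last first.
  move=> _ /orbitP[v Gv <-]; rewrite -(card_rcoset (fiber_stab w) v) -{1}astab_word.
  rewrite -amove_act ?inE // -sum1_card big_distrr /=.
  by apply: eq_big => [u|u /andP[_ /eqP ->]]; rewrite ?muln1 // !inE.
rewrite -big_distrl /= natrM mulrC mulfK ?pnatr_eq0 -?lt0n ?cardG_gt0 //.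
congr _%:R%R; rewrite -sum1_card big_mkcond [RHS]big_mkcond /=.
by apply: eq_bigr => x _; rewrite in_setI; case: (x \in orbit _ _ _) => //=.
Qed.

Lemma card_orbit_word w : #|orbit word_action G w| * #|fiber_stab w| = m`!.
Proof. by rewrite -astab_word card_orbit_stab cardsT card_Sn. Qed.

Lemma exists_word (n : T -> nat) : \sum_x n x = m -> exists w, content w =1 n.
Proof.
move=> n_m; pose s := flatten [seq nseq (n x) x | x <- enum T].
have size_s : size s == m.
  rewrite size_flatten /shape -map_comp sumnE big_map big_enum /=.
  by apply/eqP; rewrite -n_m; apply: eq_bigr => x _; rewrite /= size_nseq.
exists [ffun i => tnth (Tuple size_s) i] => y.
transitivity (count_mem y [seq tnth (Tuple size_s) i | i <- enum 'I_m]).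
  rewrite /content count_map cardE size_filter enumT; apply: eq_count => i.
  by rewrite /= inE ffunE.
rewrite map_tnth_enum /=.
rewrite count_flatten -map_comp sumnE big_map big_enum /= (bigD1 y) //=.
rewrite count_nseq /= eqxx mul1n big1 ?addn0 // => x ne_x.
by rewrite count_nseq /= (negPf ne_x).
Qed.

End Action.


Section PairWords.
Variables a b : nat.
Implicit Types w : {ffun 'I_m -> 'I_a * 'I_b}.

Definition left_word w : {ffun 'I_m -> 'I_a} := [ffun i => (w i).1].
Definition right_word w : {ffun 'I_m -> 'I_b} := [ffun i => (w i).2].

Definition content_mx w :=
  [seq [seq content w (i, j) | j <- enum 'I_b] | i <- enum 'I_a].

Lemma left_content w i : content (left_word w) i = \sum_j content w (i, j).
Proof.
rewrite /content -sum1dep_card (partition_big (fun t => (w t).2) predT) //=.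
apply: eq_bigr => j _; rewrite -sum1dep_card; apply: eq_bigl => t.
by rewrite ffunE -pair_eqE.
Qed.

Lemma right_content w j : content (right_word w) j = \sum_i content w (i, j).
Proof.
rewrite /content -sum1dep_card (partition_big (fun t => (w t).1) predT) //=.
apply: eq_bigr => i _; rewrite -sum1dep_card; apply: eq_bigl => t.
by rewrite ffunE -pair_eqE andbC.
Qed.

Lemma nth_content_mx w (i : 'I_a) (j : 'I_b) :
  nth 0 (nth [::] (content_mx w) i) j = content w (i, j).
Proof.
rewrite (nth_map i) ?size_enum_ord // (nth_map j) ?size_enum_ord //.
by rewrite !nth_ord_enum.
Qed.

Lemma content_mxP w w' : content w =1 content w' <-> content_mx w = content_mx w'.
Proof.
split=> [eq_c|eq_c [i j]]; last by rewrite -!nth_content_mx eq_c.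
by apply: eq_map => i; apply: eq_map => j; apply: eq_c.
Qed.

Variables (f : {ffun 'I_m -> 'I_a}) (g : {ffun 'I_m -> 'I_b}).

(** The product of the orbits of [f] and [g], encoded as words in pairs of letters so that the
    diagonal action is again the action on words and its orbits are classified by content. *)
Definition pair_words : {set {ffun 'I_m -> 'I_a * 'I_b}} :=
  [set w | (left_word w \in orbit (@word_action _) G f)
         & (right_word w \in orbit (@word_action _) G g)].

(** The margins of a content matrix are the contents of the two projected words; conversely
    [exists_word] realizes any matrix with these margins. *)
Lemma pair_words_content_mx A :
  (A \in [seq content_mx w | w <- enum pair_words]) =
  (A \in margin_mxs [seq content f i | i <- enum 'I_a]
                    [seq content g j | j <- enum 'I_b]).
Proof.
apply/mapP/margin_mxsP => [[w]|[A_r A_s A_c]].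
  rewrite mem_enum inE => /andP[/orbit_wordP f_w /orbit_wordP g_w] ->; split.
  - rewrite -map_comp; apply: eq_map => i /=.
    by rewrite f_w left_content sumnE big_map big_enum.
  - by move=> _ /mapP[i _ ->]; rewrite !size_map.
  - move=> j; rewrite big_map big_enum /=.
    have [lt_j|le_j] := ltnP j b; last first.
      by rewrite big1 => [|i _]; rewrite nth_default // size_map size_enum_ord.
    have nth_j : nth (Ordinal lt_j) (enum 'I_b) j = Ordinal lt_j.
      exact: (nth_ord_enum _ (Ordinal lt_j)).
    rewrite (nth_map (Ordinal lt_j)) ?size_enum_ord // nth_j g_w right_content.
    by apply: eq_bigr => i _; rewrite (nth_map (Ordinal lt_j)) ?size_enum_ord ?nth_j.
have size_A : size A = a by rewrite -(size_map sumn) A_r size_map size_enum_ord.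
pose n (x : 'I_a * 'I_b) := nth 0 (nth [::] A x.1) x.2.
have size_row (i : 'I_a) : size (nth [::] A i) = b.
  have A_i : nth [::] A i \in A by rewrite mem_nth // size_A.
  by rewrite (A_s _ A_i) size_map size_enum_ord.
have n_row i : \sum_j n (i, j) = content f i.
  transitivity (sumn (nth [::] A i)); first by rewrite sumnE (big_nth 0) size_row big_mkord.
  rewrite -(nth_map _ 0) ?size_A // A_r (nth_map i) ?size_enum_ord //.
  by rewrite nth_ord_enum.
have n_col j : \sum_i n (i, j) = content g j.
  have := A_c j; rewrite (big_nth [::]) size_A big_mkord => ->.
  by rewrite (nth_map j) ?size_enum_ord // nth_ord_enum.
have sum_f : \sum_i content f i = m.
  rewrite -[RHS]card_ord -sum1_card (partition_big f predT) //=.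
  by apply: eq_bigr => i _; rewrite /content -sum1dep_card.
have [|w w_n] := @exists_word _ n.
  by rewrite -sum_f -(eq_bigr _ (fun i _ => n_row i)) pair_big; apply: eq_bigr => -[].
exists w.
  rewrite mem_enum inE; apply/andP; split; apply/orbit_wordP.
    by move=> i; rewrite left_content -n_row; apply: eq_bigr => j _; rewrite w_n.
  by move=> j; rewrite right_content -n_col; apply: eq_bigr => i _; rewrite w_n.
apply: (@eq_from_nth _ [::]) => [|i]; first by rewrite size_map size_enum_ord.
rewrite size_A => lt_i; rewrite (nth_map (Ordinal lt_i)) ?size_enum_ord //.
rewrite (nth_ord_enum _ (Ordinal lt_i)).
apply: (@eq_from_nth _ 0) => [|j].
  by rewrite size_map size_enum_ord (size_row (Ordinal lt_i)).
rewrite (size_row (Ordinal lt_i)) => lt_j; rewrite (nth_map (Ordinal lt_j)) ?size_enum_ord //.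
by rewrite (nth_ord_enum _ (Ordinal lt_j)) w_n.
Qed.

Lemma size_undup_map (S : eqType) (T U : eqType) (h : S -> T) (k : S -> U) (s : seq S) :
  {in s &, forall x y, (h x == h y) = (k x == k y)} ->
  size (undup (map h s)) = size (undup (map k s)).
Proof.
elim: s => //= x s IHs eq_hk; have eq_s : size (undup (map h s)) = size (undup (map k s)).
  by apply: IHs => y z s_y s_z; apply: eq_hk; rewrite inE ?s_y ?s_z orbT.
have -> : (h x \in map h s) = (k x \in map k s).
  apply/mapP/mapP=> -[y s_y /eqP eq_xy]; exists y => //; apply/eqP.
    by rewrite -eq_hk // inE ?eqxx ?s_y ?orbT.
  by rewrite eq_hk // inE ?eqxx ?s_y ?orbT.
by case: ifP => _ //=; rewrite eq_s.
Qed.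

Lemma card_orbits_pair_words :
  #|orbit (@word_action _) G @: pair_words| =
  size (margin_mxs [seq content f i | i <- enum 'I_a]
                   [seq content g j | j <- enum 'I_b]).
Proof.
transitivity (size (undup [seq orbit (@word_action _) G w | w <- enum pair_words])).
  rewrite -(card_uniqP (undup_uniq _)); apply: eq_card => O; rewrite mem_undup.
  by apply/imsetP/mapP=> -[w w_S ->]; exists w; rewrite // ?mem_enum // in w_S *.
rewrite (size_undup_map (k := content_mx)) => [|w w' _ _].
  apply/perm_size/uniq_perm; rewrite ?undup_uniq ?margin_mxs_uniq // => A.
  by rewrite mem_undup pair_words_content_mx.
apply/eqP/eqP=> [/orbit_eqP/orbit_wordP/content_mxP->//|eq_c].
by apply/orbit_eqP/orbit_wordP/content_mxP.
Qed.

Lemma pair_words_acts : [acts G, on pair_words | @word_action _].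
Proof.
have lw w u : left_word (permute_word w u) = permute_word (left_word w) u.
  by apply/ffunP=> i; rewrite !ffunE.
have rw w u : right_word (permute_word w u) = permute_word (right_word w) u.
  by apply/ffunP=> i; rewrite !ffunE.
apply/actsP=> u Gu w; rewrite !inE lw rw.
by rewrite (actsP (acts_orbit _ _ (subsetT _))) // (actsP (acts_orbit _ _ (subsetT _))).
Qed.

Lemma card_fix_pair_words u :
  #|'Fix_(pair_words | @word_action _)[u]| =
    #|'Fix_(orbit (@word_action _) G f | @word_action _)[u]|
    * #|'Fix_(orbit (@word_action _) G g | @word_action _)[u]|.
Proof.
rewrite -cardsX.
pose h (x : {ffun 'I_m -> 'I_a} * {ffun 'I_m -> 'I_b}) : {ffun 'I_m -> 'I_a * 'I_b} :=
  [ffun i => (x.1 i, x.2 i)].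
have lh x : left_word (h x) = x.1 by apply/ffunP=> i; rewrite !ffunE.
have rh x : right_word (h x) = x.2 by apply/ffunP=> i; rewrite !ffunE.
apply: (card_bij (f := fun w => (left_word w, right_word w)) (g := h)).
- move=> w; rewrite in_setI => /andP[/[!inE]/andP[-> ->]].
  rewrite !sub1set !inE => /word_fixP w_u.
  by apply/andP; split; apply/word_fixP=> i; rewrite !ffunE w_u.
- case=> x y; rewrite in_setX !in_setI => /andP[/andP[f_x x_u] /andP[g_y y_u]].
  rewrite inE lh rh f_x g_y /=; move: x_u y_u; rewrite !inE !sub1set !inE.
  by move=> /word_fixP x_u /word_fixP y_u; apply/word_fixP=> i; rewrite !ffunE x_u y_u.
- by move=> w _; apply/ffunP=> i; rewrite !ffunE; case: (w i).
- by case=> x y _; rewrite lh rh.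
Qed.

Lemma cfdot_Ind_fiber_stab :
  ('['Ind[G, fiber_stab_group f] 1, 'Ind[G, fiber_stab_group g] 1]
   = (size (margin_mxs [seq content f i | i <- enum 'I_a]
                       [seq content g j | j <- enum 'I_b]))%:R)%R.
Proof.
rewrite cfdotE -card_orbits_pair_words.
have := Frobenius_Cauchy pair_words_acts; rewrite (eq_bigr _ (fun u _ => card_fix_pair_words u)).
move=> eq_s; transitivity (#|G|%:R^-1 * (#|orbit (@word_action _) G @: pair_words| * #|G|)%:R : algC)%R.
  rewrite -eq_s natr_sum; congr (_ * _)%R; apply: eq_bigr => u _.
  by rewrite !Ind_fiber_stab conjC_nat natrM.
by rewrite natrM mulrC mulfK // pnatr_eq0 -lt0n cardG_gt0.
Qed.

End PairWords.

End Words.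

(** * Orders of Young subgroups *)

Section CardFiberStab.
Variables (m : nat) (T : finType) (f : {ffun 'I_m -> T}).

(* The permutations in the stabilizer of this word are those that preserve f
   and move only positions where f takes a value in s. *)
Let restrict (s : seq T) (i : 'I_m) : T + 'I_m := if f i \in s then inl (f i) else inr i.

Let restrictP s (u : 'S_m) :
  reflect (forall i, if f i \in s then f (u i) = f i else u i = i)
          (u \in fiber_stab (restrict s)).
Proof.
apply: (iffP (fiber_stabP _ _)) => us i; have := us i; rewrite /restrict.
  by case: ifP => s_u; case: ifP => s_i // [].
by case: ifP => s_i ->; rewrite s_i.
Qed.

(** Adding a letter [x] to [s] multiplies the stabilizer by the symmetric group on the fiber of [x],
    which meets the old stabilizer trivially. *)
Let card_restrict s : uniq s ->
  #|fiber_stab (restrict s)| = \prod_(x <- s) (content f x)`!.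
Proof.
elim: s => [|x s IHs].
  move=> _; rewrite big_nil -(cards1 (1%g : 'S_m)); congr #|pred_of_set _|.
  apply/setP=> u; rewrite in_set1; apply/restrictP/eqP=> [u1|-> i].
    by apply/permP=> i; rewrite perm1; exact: u1.
  by rewrite /= perm1.
rewrite cons_uniq => /andP[s'x uniq_s]; rewrite big_cons -{}IHs //.
pose A := [set i | f i == x]; rewrite /content -/A.
have defA i : (i \in A) = (f i == x) by rewrite inE.
rewrite -(perm.card_Sym A) -TI_cardMg; last first.
  apply/trivgP/subsetP=> u; rewrite in_setI in_set => /andP[Au /restrictP us].
  rewrite in_set1; apply/eqP/permP=> i; rewrite perm1.
  have [A_i|A'i] := boolP (i \in A); last exact: (out_perm Au).
  by have := us i; move: A_i; rewrite defA => /eqP ->; rewrite (negPf s'x).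
congr #|pred_of_set _|; apply/setP=> u; apply/restrictP/mulsgP => [us|[v w]].
  have u_A i : (u i \in A) = (i \in A).
    rewrite !defA; have := us i; rewrite inE; case: eqP => [f_i|ne_x] /=.
      by rewrite f_i => ->; rewrite eqxx.
    by case: ifP => _ -> //; apply/negbTE/eqP.
  have nA : u \in 'N(A | 'P) by apply/astabsP=> i; apply: u_A.
  have onA := restr_perm_on A u.
  exists (restr_perm A u) ((restr_perm A u)^-1 * u)%g; last by rewrite mulKVg.
    by rewrite in_set.
  apply/restrictP=> i; rewrite permM.
  have [A_i|A'i] := boolP (i \in A).
    have A_j : ((restr_perm A u)^-1)%g i \in A by rewrite -(perm_closed _ onA) permKV.
    have := A_i; rewrite defA => /eqP->; rewrite (negPf s'x).
    by rewrite -(restr_permE nA A_j) permKV.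
  have -> : ((restr_perm A u)^-1)%g i = i.
    by apply: (perm_inj (s := restr_perm A u)); rewrite permKV (out_perm onA).
  by have := us i; rewrite inE -defA (negPf A'i).
rewrite in_set => Av /restrictP ws -> i; rewrite permM inE.
have [A_i|A'i] := boolP (i \in A).
  have := A_i; rewrite -(perm_closed _ Av) => A_vi; have := ws (v i).
  move: A_i A_vi; rewrite !defA => /eqP f_i /eqP f_vi.
  by rewrite f_i f_vi (negPf s'x) eqxx /= => ->.
by rewrite (out_perm Av A'i) -defA (negPf A'i); apply: ws.
Qed.

Lemma card_fiber_stab : #|fiber_stab f| = \prod_x (content f x)`!.
Proof.
rewrite -big_enum /= -card_restrict ?enum_uniq //; congr #|pred_of_set _|.
apply/setP=> u; apply/fiber_stabP/restrictP=> us i; have := us i; rewrite mem_enum //=.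
Qed.

End CardFiberStab.

(** * [Q] as a number of fixed words *)

Section QWords.
Variables (m d : nat) (g : 'S_m).
Implicit Type w : {ffun 'I_m -> 'I_d.+1}.

(** A word fixed by [g] is constant on each cycle. Its letter on the [k]-th cycle is the unknown
    [t_k], and the length of the cycle is the coefficient of [t_k] in the sum of the letters. *)
Lemma nb_solutions_cycles (cs : seq {set 'I_m}) : uniq cs -> cs =i porbits g ->
  nb_solutions d [seq #|C| | C : {set 'I_m} <- cs] =
  #|[set w : {ffun 'I_m -> 'I_d.+1} | (permute_word w g == w) & \sum_i w i == d]|.
Proof.
move=> cs_uniq cs_g; rewrite /nb_solutions; set n := size _.
have n_cs : n = size cs by rewrite /n size_map.
have lt_idx i : index (porbit g i) cs < n by rewrite n_cs index_mem cs_g imset_f.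
pose idx i : 'I_n := Ordinal (lt_idx i).
pose cyc (k : 'I_n) := nth set0 cs k.
have cyc_cs k : cyc k \in cs by rewrite mem_nth // -n_cs.
have idxP i k : (idx i == k) = (i \in cyc k).
  apply/eqP/idP => [<-|].
    by rewrite /cyc /= nth_index ?porbit_id // cs_g imset_f.
  have := cyc_cs k; rewrite cs_g => /imsetP[j _ def_k]; rewrite def_k.
  rewrite -eq_porbit_mem => /eqP eq_ij; apply/val_inj; rewrite /= eq_ij -def_k.
  by rewrite index_uniq // -n_cs.
have sum_idx (h : 'I_n -> nat) : \sum_i h (idx i) = \sum_k #|cyc k| * h k.
  rewrite (partition_big idx predT) //=; apply: eq_bigr => k _.
  rewrite (eq_bigr (fun=> h k)) => [|i /eqP-> //].
  by rewrite (eq_bigl (mem (cyc k))) ?sum_nat_const // => i; rewrite idxP.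
have nth_card (k : 'I_n) : nth 0 [seq #|C| | C : {set 'I_m} <- cs] k = #|cyc k|.
  by rewrite (nth_map set0) // -n_cs.
(* Cycles are nonempty, so the default [ord0] is never reached. *)
pose F w : n.-tuple 'I_d.+1 := [tuple if [pick i in cyc k] is Some i then w i else ord0 | k < n].
pose H (t : n.-tuple 'I_d.+1) : {ffun 'I_m -> 'I_d.+1} := [ffun i => tnth t (idx i)].
have F_idx w i : permute_word w g == w -> tnth (F w) (idx i) = w i.
  move=> /word_fixP w_g; rewrite tnth_mktuple; case: pickP => [j|/(_ i)]; last first.
    by rewrite -idxP eqxx.
  rewrite -idxP => /eqP eq_ij.
  have : i \in cyc (idx j) by rewrite -idxP eq_ij.
  rewrite /cyc /= nth_index ?cs_g ?imset_f // => /porbitP[k ->].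
  elim: k => [|k IHk]; first by rewrite perm1.
  by rewrite expgSr permM w_g.
apply: (card_bij (f := H) (g := F)).
- move=> t; rewrite !inE => /eqP t_d; apply/andP; split.
    apply/word_fixP=> i; rewrite !ffunE; congr tnth; apply/val_inj; rewrite /=.
    by rewrite -[g in porbit g (g i)]expg1 porbit_perm ?expg1.
  apply/eqP; rewrite (eq_bigr (fun i => tnth t (idx i) : nat)) => [|i _]; last by rewrite ffunE.
  by rewrite (sum_idx (fun k => tnth t k)) -[RHS]t_d; apply: eq_bigr => k _; rewrite nth_card.
- move=> w; rewrite !inE => /andP[w_g /eqP w_d].
  rewrite (eq_bigr (fun k => #|cyc k| * tnth (F w) k)) => [|k _]; last by rewrite nth_card.
  rewrite -(sum_idx (fun k => tnth (F w) k)) -[X in _ == X]w_d; apply/eqP.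
  by apply: eq_bigr => i _; rewrite F_idx.
- move=> t t_in; apply: eq_from_tnth => k; have := cyc_cs k.
  rewrite cs_g => /imsetP[j _ def_k]; have: j \in cyc k by rewrite def_k porbit_id.
  rewrite -idxP => /eqP <-; rewrite F_idx ?ffunE //.
  apply/word_fixP=> i; rewrite !ffunE; congr tnth; apply/val_inj; rewrite /=.
  by rewrite -[g in porbit g (g i)]expg1 porbit_perm ?expg1.
- by move=> w; rewrite inE => /andP[w_g _]; apply/ffunP=> i; rewrite ffunE F_idx.
Qed.

Lemma Q_words :
  (Q m d g = #|[set w : {ffun 'I_m -> 'I_d.+1} | (permute_word w g == w) & (\sum_i w i == d)%N]|%:R)%R.
Proof.
rewrite cfunE /cycle_type sort_map nb_solutions_cycles //.
  by rewrite sort_uniq enum_uniq.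
by move=> C; rewrite mem_sort mem_enum.
Qed.

End QWords.

(** * Young's rule *)

Local Open Scope ring_scope.

Definition young_char (m : nat) (T : eqType) (f : 'I_m -> T) : 'CF([set: 'S_m]) :=
  'Ind[[set: 'S_m], fiber_stab_group f] 1.

Lemma eq_young_char (m : nat) (T T' : eqType) (f : 'I_m -> T) (f' : 'I_m -> T') :
  (forall i j, (f i == f j) = (f' i == f' j)) -> young_char f = young_char f'.
Proof.
move=> eq_ff'; rewrite /young_char; suff -> : fiber_stab_group f = fiber_stab_group f' by [].
by apply/group_inj/setP=> u; rewrite !inE; apply: eq_forallb => i; rewrite eq_ff'.
Qed.

(** Words with the same content share an orbit, and the permutation character depends on the orbit
    alone. *)
Lemma young_char_orbit (m : nat) (T : finType) (w w' : {ffun 'I_m -> T}) :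
  content w =1 content w' -> young_char w = young_char w'.
Proof.
move/orbit_wordP/orbit_eqP=> eq_ww'; apply/cfunP=> g.
by rewrite /young_char !Ind_fiber_stab eq_ww'.
Qed.

Section YoungRule.
Variable m : nat.
Local Notation G := [set: 'S_m].
Implicit Types p q la : intpartn m.

Lemma card_rrow p k : #|[set i | rrow p i == k]| = nth 0%N p k.
Proof.
have := card_rrow_lt p k.+1; rewrite sumn_take big_ord_recr /= -sumn_take -card_rrow_lt.
rewrite (_ : [set i | (rrow p i < k.+1)%N] = [set i | (rrow p i < k)%N] :|: [set i | rrow p i == k]).
  rewrite cardsU (_ : _ :&: _ = set0) ?cards0 ?subn0; first exact: addnI.
  by apply/setP=> i; rewrite !inE; case: ltngtP.
by apply/setP=> i; rewrite !inE ltnS leq_eqVlt orbC.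
Qed.

Lemma rrow_lt p i : (rrow p i < size p)%N.
Proof. by apply: reshape_indexP; rewrite intpartn_sumn. Qed.

(* The rows are numbered backwards because [sum_Kostka2] reverses contents. *)
Definition row_word p : {ffun 'I_m -> 'I_(size p)} :=
  [ffun i => rev_ord (Ordinal (rrow_lt p i))].

Lemma content_row_word p : [seq content (row_word p) k | k <- enum 'I_(size p)] = rev p.
Proof.
apply: (@eq_from_nth _ 0%N); rewrite size_map size_enum_ord ?size_rev // => k lt_k.
rewrite (nth_map (Ordinal lt_k)) ?size_enum_ord // (nth_ord_enum _ (Ordinal lt_k)).
rewrite nth_rev // -card_rrow /content; apply: eq_card => i; rewrite !inE ffunE.
by rewrite -val_eqE /=; have lt_r := rrow_lt p i; apply/eqP/eqP; lia.
Qed.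

Lemma young_char_row_word p : young_char (row_word p) = young_char (rrow p).
Proof.
apply: eq_young_char => i j; rewrite !ffunE (inj_eq rev_ord_inj) -val_eqE //.
Qed.

Lemma cfdot_young_char la p :
  '[young_char (rrow la), young_char (rrow p)] =
    (\sum_(q : intpartn m) Kostka q la * Kostka q p)%:R.
Proof.
by rewrite -!young_char_row_word /young_char cfdot_Ind_fiber_stab !content_row_word sum_Kostka2.
Qed.

Lemma dominated_refl p : dominated p p.
Proof. by apply/dominatedP. Qed.

Lemma dominated_trans p q la : dominated p q -> dominated q la -> dominated p la.
Proof. by move=> /dominatedP pq /dominatedP ql; apply/dominatedP=> i; apply: leq_trans (pq i) (ql i). Qed.

(** The induction carries the pairings with every [M^la]: those with general [la] give [M_X], and
    those with [la = p] show that [X] is orthogonal to the Specht characters subtracted from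
    [M^p]. *)
Lemma young_rule_step p :
  (forall q, dominated p q -> q != p ->
     forall la, '[young_char (rrow la), specht_char m q] = (Kostka q la)%:R) ->
  specht_char m p = young_char (rrow p)
    - \sum_(q : intpartn m | dominated p q && (q != p)) (Kostka q p)%:R *: specht_char m q
  /\ (forall la, '[young_char (rrow la), specht_char m p] = (Kostka p la)%:R).
Proof.
move=> IHp; set S := \sum_(q | _) _; set X := _ - S.
have M_X la : '[young_char (rrow la), X] = (Kostka p la)%:R.
  rewrite cfdotBr cfdot_young_char cfdot_sumr.
  rewrite (eq_bigr (fun q : intpartn m => (Kostka q la * Kostka q p)%:R : algC)) => [|q /andP[pq ne_q]]; last first.
    by rewrite cfdotZr conjC_nat IHp // mulrC natrM.
  rewrite natr_sum (bigID (fun q : intpartn m => dominated p q)) /= (bigD1 p) ?dominated_refl //=.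
  rewrite [X in _ + X - _]big1 ?addr0 => [|q ndom]; last first.
    have [->|nz] := eqVneq (Kostka q p) 0%N; first by rewrite muln0.
    by rewrite (Kostka_dominated nz) in ndom.
  by rewrite Kostka_diag muln1 addrK.
have s_X q : dominated p q -> q != p -> '[specht_char m q, X] = 0.
  move=> pq ne_q; rewrite cfdotBr cfdotC IHp // conjC_nat cfdot_sumr.
  rewrite (bigD1 q) ?pq ?ne_q //= cfdotZr cfnorm_specht conjC_nat mulr1.
  rewrite big1 ?addr0 ?subrr // => q' /andP[_ ne_q'].
  by rewrite cfdotZr cfdot_specht eq_sym (negPf ne_q') mulr0.
have norm_X : '[X] = 1.
  rewrite {1}/X cfdotBl M_X Kostka_diag cfdot_suml big1 ?subr0 // => q /andP[pq ne_q].
  by rewrite cfdotZl s_X ?mulr0.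
have X_s : '[X, specht_char m p] = 1.
  rewrite cfdotBl /young_char cfdot_specht_Ind cfdot_suml big1 ?subr0 // => q /andP[_ ne_q].
  by rewrite cfdotZl cfdot_specht (negPf ne_q) mulr0.
suff eq_sX : specht_char m p = X by split=> // la; rewrite eq_sX.
apply/esym/eqP; rewrite -subr_eq0 -cfnorm_eq0 cfnormB norm_X cfnorm_specht X_s.
by rewrite conjC1 subrr.
Qed.

Lemma cfdot_young_specht p la :
  '[young_char (rrow la), specht_char m p] = (Kostka p la)%:R.
Proof.
(* The descending induction runs on the number of partitions that dominate [p]. *)
have [n] := ubnP #|[set q : intpartn m | dominated p q]|; elim: n p la => // n IHn p la le_n.
apply: (young_rule_step _).2 => q pq ne_q la'; apply: IHn.
rewrite -ltnS; apply: leq_trans le_n; rewrite ltnS; apply: proper_card.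
rewrite properE; apply/andP; split.
  by apply/subsetP=> q'; rewrite !inE; apply: dominated_trans.
apply/subsetPn; exists p; rewrite inE ?dominated_refl //.
by apply: contra ne_q => qp; apply/eqP/dominated_anti.
Qed.

Theorem young_rule p :
  young_char (rrow p) = \sum_(q : intpartn m | dominated p q) (Kostka q p)%:R *: specht_char m q.
Proof.
rewrite (bigD1 p) ?dominated_refl //= Kostka_diag scale1r.
rewrite (young_rule_step (fun q _ _ la => cfdot_young_specht q la)).1.
by rewrite subrK.
Qed.

End YoungRule.

(** * From tuples to multiplicity partitions *)

Section MultiplicityPartition.
Variables (m d : nat) (a : m.-tuple 'I_d.+1).

Definition word_of : {ffun 'I_m -> 'I_d.+1} := [ffun i => tnth a i].

Lemma content_word_of j : content word_of j = count_mem j a.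
Proof.
transitivity (count_mem j [seq tnth a i | i <- enum 'I_m]); last by rewrite map_tnth_enum.
rewrite count_map /content cardE size_filter enumT.
by apply: eq_count => i; rewrite /= inE ffunE.
Qed.

Lemma card_stab_word_of : #|fiber_stab word_of| = partn_fact (mult_partn a).
Proof.
rewrite card_fiber_stab /partn_fact /mult_partn (perm_big _ (permEl (perm_sort _ _))) /=.
rewrite big_filter [RHS]big_mkcond big_map big_enum /=; apply: eq_bigr => j _.
by rewrite content_word_of; case: eqP => // ->.
Qed.

Definition mult_intpartn : intpartn m := IntPartn (mult_partn_is_intpartn a).

(* Renaming row k to the k-th value of a in order of multiplicity turns rrow
   into a rearrangement of a. *)
Lemma young_char_word_of : young_char word_of = young_char (rrow mult_intpartn).
Proof.
pose vals := sort (relpre (fun j => count_mem j a) geq)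
  [seq j <- enum 'I_d.+1 | count_mem j a != 0%N].
have vals_p : [seq count_mem j a | j <- vals] = mult_intpartn.
  by rewrite /vals -sort_map /= /mult_partn [in RHS]filter_map.
have size_v : size vals = size mult_intpartn by rewrite -vals_p size_map.
have vals_uniq : uniq vals by rewrite sort_uniq filter_uniq ?enum_uniq.
pose w : {ffun 'I_m -> 'I_d.+1} := [ffun i => nth ord0 vals (rrow mult_intpartn i)].
have lt_v i : (rrow mult_intpartn i < size vals)%N by rewrite size_v rrow_lt.
rewrite -(eq_young_char (f := w) (f' := rrow mult_intpartn)) => [|i j]; last by rewrite !ffunE nth_uniq.
apply: young_char_orbit => j; rewrite content_word_of.
have [/(nthP ord0)[k lt_k <-]|v'j] := boolP (j \in vals).
  rewrite -(nth_map _ 0%N (fun j => count_mem j a)) // vals_p -card_rrow.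
  by apply: eq_card => i; rewrite !inE ffunE nth_uniq.
have -> : count_mem j a = 0%N.
  by move: v'j; rewrite mem_sort mem_filter mem_enum andbT negbK => /eqP.
apply/esym/eqP; rewrite cards_eq0 -subset0; apply/subsetP=> i; rewrite inE ffunE => /eqP def_j.
by case/negP: v'j; rewrite -def_j mem_nth.
Qed.

End MultiplicityPartition.

(** Double count of pairs [(w, v)] with [v] fixed by [g] in the orbit of [w], weighted by
    [#|fiber_stab w|]. Summing over [v] yields the values of the Young characters; summing over [w]
    yields [m!] for every [v], since stabilizers along an orbit have equal order. The sum of the
    letters is constant on orbits. *)
Lemma Q_young_chars (m d : nat) :
  m`!%:R *: Q m d =
    \sum_(w : {ffun 'I_m -> 'I_d.+1} | (\sum_i w i == d)%N) #|fiber_stab w|%:R *: young_char w.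
Proof.
apply/cfunP=> g; rewrite cfunE Q_words sum_cfunE -natrM.
pose orb (w : {ffun 'I_m -> 'I_d.+1}) := orbit (@word_action _ _) [set: 'S_m] w.
rewrite (eq_bigr (fun w => (\sum_(v in orb w | permute_word v g == v) #|fiber_stab w|)%:R)); last first.
  move=> w _; rewrite cfunE /young_char Ind_fiber_stab -natrM mulnC -sum_nat_const.
  congr _%:R; apply: eq_bigl => v; rewrite in_setI; congr (_ && _).
  by apply/afix1P/eqP.
rewrite -natr_sum; congr _%:R.
have sum_orb (w v : {ffun 'I_m -> 'I_d.+1}) : v \in orb w -> (\sum_i v i = \sum_i w i)%N.
  case/orbitP=> u _ <-; rewrite [RHS](reindex_inj (@perm_inj _ u^-1%g)).
  by apply: eq_bigr => i _; rewrite ffunE.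
rewrite (exchange_big_dep (fun v : {ffun 'I_m -> 'I_d.+1} => (permute_word v g == v) && (\sum_i v i == d)%N)) /=;
  last first.
  by move=> w v w_d /andP[/sum_orb -> ->].
rewrite mulnC -sum_nat_const; apply: eq_big => [v|v]; rewrite inE // => /andP[v_g /eqP v_d].
rewrite (eq_bigl (mem (orb v))) => [|w]; last first.
  rewrite v_g andbT orbit_sym andb_idl // => /sum_orb ->; exact/eqP.
rewrite (eq_bigr (fun=> #|fiber_stab v|)) => [|w /orbit_eqP eq_wv].
  by rewrite sum_nat_const card_orbit_word.
have := card_orbit_word w; rewrite eq_wv -(card_orbit_word v) => /eqP.
rewrite eqn_pmul2l => [/eqP //|]; rewrite card_gt0; apply/set0Pn; exists v; exact: orbit_refl.
Qed.

Theorem theoremB (m d : nat) (m_gt0 : (0 < m)%N) (d_gt0 : (0 < d)%N) :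
  Q m d =
    (m`!)%:R^-1 *:
      \sum_(a in Gamma m d)
        \sum_(pi : intpartn m | dominated (mult_partn a) pi)
          (partn_fact (mult_partn a) * Kostka pi (mult_partn a))%:R
            *: specht_char m pi.
Proof.
have nz : m`!%:R != 0 :> algC by rewrite pnatr_eq0 -lt0n fact_gt0.
apply: (scalerI nz); rewrite scalerA mulfV // scale1r Q_young_chars.
rewrite (reindex_onto (@word_of m d) (fun w => [tuple w i | i < m])) /=; last first.
  by move=> w _; apply/ffunP=> i; rewrite ffunE tnth_mktuple.
apply: eq_big => [a|a _].
  rewrite inE (eq_bigr (fun i => tnth a i : nat)) => [|i _]; last by rewrite ffunE.
  rewrite andb_idr // => _; apply/eqP/eq_from_tnth=> i.
  by rewrite tnth_mktuple ffunE.
rewrite young_char_word_of card_stab_word_of young_rule scaler_sumr.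
by apply: eq_bigr => p _; rewrite scalerA natrM.
Qed.
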